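(* Let $\varphi\in C_c^2(D_1)$. (a) If $f=\mathrm{d}^2\varphi$, then $f$ can be reconstructed from $\mathcal{L}f$ or from $\mathcal{M}f$ using the formulas, valid for all $x\in\mathbb{R}^2$, $$\varphi(x)=\frac{1}{2u_2}\int_0^\infty\mathcal{L}f(x+s e_2)\,ds=-\frac{1}{2u_2}\int_0^\infty\mathcal{M}f(x+s e_1)\,ds.$$ (b) If $f=(\mathrm{d}^\perp)^2\varphi$, then $f$ can be reconstructed from $\mathcal{T}f$ or from $\mathcal{M}f$ using the formulas $$\varphi(x)=\frac{1}{2u_2}\int_0^\infty\mathcal{T}f(x+s e_2)\,ds=\frac{1}{2u_2}\int_0^\infty\mathcal{M}f(x+s e_1)\,ds.$$ (c) If $f=\mathrm{d}\mathrm{d}^\perp\varphi$, then $f$ can be reconstructed from $\mathcal{L}f$ or from $\mathcal{T}f$ using the formulas $$\varphi(x)=\frac{1}{2u_2}\int_0^\infty\mathcal{L}f(x+s e_1)\,ds=-\frac{1}{2u_2}\int_0^\infty\mathcal{T}f(x+s e_1)\,ds.$$ In this case, $f$ can also be reconstructed from $\mathcal{M}f$ by solving for $\varphi$ the second order partial differential equation $$(1+2u_1^2)\frac{\partial^2\varphi}{\partial x_1^2}+(u_1^2-u_2^2)\frac{\partial^2\varphi}{\partial x_2^2}=-\frac{1}{u_2}\mathcal{X}_{e_2}\left(D_uD_v\mathcal{M}f\right)$$ with appropriate (homogeneous) initial/boundary conditions; that is, $\varphi$ satisfies this equation and is the only function in $C_c^2(D_1)$ satisfying it.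
   Context: $D_1\subset\mathbb{R}^2$ is an open disc of radius $r_1>0$ centered at the origin; $C_c^2(D_1)$ is the space of twice continuously differentiable functions with compact support in $D_1$ (extended by zero to $\mathbb{R}^2$). $e_1=(1,0)$, $e_2=(0,1)$. For a scalar function $\varphi$: $\mathrm{d}\varphi=(\partial_{x_1}\varphi,\partial_{x_2}\varphi)$ and $\mathrm{d}^\perp\varphi=(-\partial_{x_2}\varphi,\partial_{x_1}\varphi)$. For a vector field $g=(g_1,g_2)$, $\mathrm{d}g$ and $\mathrm{d}^\perp g$ are the symmetric $2$-tensor fields $$(\mathrm{d}g)_{ij}=\tfrac12\left(\tfrac{\partial g_i}{\partial x_j}+\tfrac{\partial g_j}{\partial x_i}\right),\qquad (\mathrm{d}^\perp g)_{ij}=\tfrac12\left((-1)^j\tfrac{\partial g_i}{\partial x_{3-j}}+(-1)^i\tfrac{\partial g_j}{\partial x_{3-i}}\right).$$ Thus $\mathrm{d}^2\varphi=\mathrm{d}(\mathrm{d}\varphi)$, $(\mathrm{d}^\perp)^2\varphi=\mathrm{d}^\perp(\mathrm{d}^\perp\varphi)$, $\mathrm{d}\mathrm{d}^\perp\varphi=\mathrm{d}(\mathrm{d}^\perp\varphi)$. For symmetric $2$-tensors, $\langle f,h\rangle=f_{11}h_{11}+2f_{12}h_{12}+f_{22}h_{22}$. For vectors $a,b\in\mathbb{R}^2$, $(a\odot b)_{ij}=\frac12(a_ib_j+a_jb_i)$, $a^2=a\odot a$, $a^\perp=(-a_2,a_1)$. For a unit vector $a$, $\mathcal{X}_a h(x)=\int_0^\infty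 h(x+ta)\,dt$ and $D_a h=a\cdot\nabla h$. Derivatives that do not exist classically (and $\mathcal{X}_{e_2}$ applied to the compactly supported $D_uD_v\mathcal{M}f$) are understood in the sense of distributions. Fix unit vectors $u=(u_1,u_2)$ and $v=(-u_1,u_2)$ that are linearly independent (so $u_1u_2\neq0$, i.e. $-1<u_1^2-u_2^2<1$). For a continuous compactly supported symmetric $2$-tensor field $f$, the longitudinal, transverse and mixed V-line transforms are the functions on $\mathbb{R}^2$ $$\mathcal{L}f=\mathcal{X}_u\langle f,u^2\rangle+\mathcal{X}_v\langle f,v^2\rangle,\quad \mathcal{T}f=\mathcal{X}_u\langle f,(u^\perp)^2\rangle+\mathcal{X}_v\langle f,(v^\perp)^2\rangle,\quad \mathcal{M}f=\mathcal{X}_u\langle f,u\odot u^\perp\rangle+\mathcal{X}_v\langle f,v\odot v^\perp\rangle.$$ *)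

(* Defs.v *)
(* Stdlib real numbers with Coquelicot. *)
From Stdlib Require Export Reals.
From Coquelicot Require Export Coquelicot.
Open Scope R_scope.

Definition R2 : Type := (R * R)%type.

Definition e1 : R2 := (1, 0).
Definition e2 : R2 := (0, 1).
Definition perp (a : R2) : R2 := (- snd a, fst a).

(* The point x + t a. *)
Definition shift (x : R2) (t : R) (a : R2) : R2 :=
  (fst x + t * fst a, snd x + t * snd a).

Definition unit_vector (a : R2) : Prop := fst a ^ 2 + snd a ^ 2 = 1.

Definition lin_indep (a b : R2) : Prop :=
  forall s t : R,
    s * fst a + t * fst b = 0 -> s * snd a + t * snd b = 0 -> s = 0 /\ t = 0.

(* The index set {1,2}: [other i] is 3 - i and [sgn i] is (-1)^i. *)
Inductive ix : Set := i1 | i2.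
Definition other (i : ix) : ix := match i with i1 => i2 | i2 => i1 end.
Definition sgn (i : ix) : R := match i with i1 => -1 | i2 => 1 end.
Definition coord (i : ix) (a : R2) : R :=
  match i with i1 => fst a | i2 => snd a end.

Definition pd (i : ix) (h : R2 -> R) (x : R2) : R :=
  match i with
  | i1 => Derive (fun t => h (t, snd x)) (fst x)
  | i2 => Derive (fun t => h (fst x, t)) (snd x)
  end.

Definition ex_pd (i : ix) (h : R2 -> R) (x : R2) : Prop :=
  match i with
  | i1 => ex_derive (fun t => h (t, snd x)) (fst x)
  | i2 => ex_derive (fun t => h (fst x, t)) (snd x)
  end.

Definition Dir (a : R2) (h : R2 -> R) : R2 -> R :=
  fun x => fst a * pd i1 h x + snd a * pd i2 h x.

Fixpoint Ck (k : nat) (h : R2 -> R) : Prop :=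
  (forall x : R2, continuous h x) /\
  match k with
  | O => True
  | S k' => forall i : ix, (forall x : R2, ex_pd i h x) /\ Ck k' (pd i h)
  end.

(* Topological support: the closure of {h <> 0}. *)
Definition supp (h : R2 -> R) (x : R2) : Prop :=
  ~ locally x (fun y : R2 => h y = 0).

Definition disc (r : R) (x : R2) : Prop := fst x ^ 2 + snd x ^ 2 < r ^ 2.

(* C_c^k of the open disc of radius r, extended by zero.  The support is closed
   in the plane and the disc is bounded, so inclusion makes it compact. *)
Definition Cck (k : nat) (r : R) (h : R2 -> R) : Prop :=
  Ck k h /\ forall x : R2, supp h x -> disc r x.

Definition test_function (psi : R2 -> R) : Prop :=
  (forall k : nat, Ck k psi) /\
  exists r : R, forall x : R2, supp psi x -> disc r x.

(* Vector fields, symmetric 2-tensors and symmetric 2-tensor fields are given by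
   their components. *)
Definition vfield : Type := ix -> R2 -> R.
Definition tensor : Type := ix -> ix -> R.
Definition tfield : Type := ix -> ix -> R2 -> R.

Definition grad (phi : R2 -> R) : vfield := fun i => pd i phi.

Definition grad_perp (phi : R2 -> R) : vfield :=
  fun i x => match i with i1 => - pd i2 phi x | i2 => pd i1 phi x end.

Definition sym_d (g : vfield) : tfield :=
  fun i j x => / 2 * (pd j (g i) x + pd i (g j) x).

Definition sym_d_perp (g : vfield) : tfield :=
  fun i j x => / 2 * (sgn j * pd (other j) (g i) x
                      + sgn i * pd (other i) (g j) x).

Definition odot (a b : R2) : tensor :=
  fun i j => / 2 * (coord i a * coord j b + coord j a * coord i b).

Definition inner (f : tfield) (h : tensor) : R2 -> R :=
  fun x => f i1 i1 x * h i1 i1 + 2 * (f i1 i2 x * h i1 i2) + f i2 i2 x * h i2 i2.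

(* Improper integral over [0, +oo), and its convergence.  [RInt_gen] is total and
   unspecified on divergent integrals, hence the separate predicate. *)
Definition half_int (g : R -> R) : R :=
  RInt_gen g (at_point 0) (Rbar_locally p_infty).
Definition ex_half_int (g : R -> R) : Prop :=
  ex_RInt_gen g (at_point 0) (Rbar_locally p_infty).

Definition Xray (a : R2) (h : R2 -> R) : R2 -> R :=
  fun x => half_int (fun t => h (shift x t a)).

Definition Lvline (u v : R2) (f : tfield) : R2 -> R :=
  fun x => Xray u (inner f (odot u u)) x + Xray v (inner f (odot v v)) x.

Definition Tvline (u v : R2) (f : tfield) : R2 -> R :=
  fun x => Xray u (inner f (odot (perp u) (perp u))) x
           + Xray v (inner f (odot (perp v) (perp v))) x.

Definition Mvline (u v : R2) (f : tfield) : R2 -> R :=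
  fun x => Xray u (inner f (odot u (perp u))) x
           + Xray v (inner f (odot v (perp v))) x.

(* Distributions on the plane, as functionals; only their values on test
   functions are meaningful. *)
Definition distr : Type := (R2 -> R) -> R.

Definition distr_eq (S T : distr) : Prop :=
  forall psi : R2 -> R, test_function psi -> S psi = T psi.

Definition distr_scal (c : R) (T : distr) : distr := fun psi => c * T psi.

(* The distribution psi |-> int h psi of a function h.  It is used for continuous
   h only, for which the iterated Riemann integral is the Lebesgue integral. *)
Definition distr_of (h : R2 -> R) : distr := fun psi =>
  RInt_gen (fun x1 =>
    RInt_gen (fun x2 => h (x1, x2) * psi (x1, x2))
      (Rbar_locally m_infty) (Rbar_locally p_infty))
    (Rbar_locally m_infty) (Rbar_locally p_infty).

Definition distr_Dir (a : R2) (T : distr) : distr := fun psi => - T (Dir a psi).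

(* The translate of T by -b, extending h |-> h (. + b). *)
Definition distr_shift (b : R2) (T : distr) : distr :=
  fun psi => T (fun y => psi (shift y (-1) b)).

(* X_a T = int_0^oo T(. + t a) dt as a weak integral, i.e. tested against each
   psi.  For a compactly supported T and a <> 0 the integrand vanishes for large
   t, and this is the pairing of T with the smooth function X_{-a} psi. *)
Definition distr_Xray (a : R2) (T : distr) : distr := fun psi =>
  half_int (fun t => distr_shift (t * fst a, t * snd a) T psi).

Definition ex_distr_Xray (a : R2) (T : distr) : Prop :=
  forall psi : R2 -> R, test_function psi ->
    ex_half_int (fun t => distr_shift (t * fst a, t * snd a) T psi).

(* psi satisfies, in the sense of distributions,
     (1 + 2 u1^2) psi_11 + (u1^2 - u2^2) psi_22 = - (1 / u2) X_{e2} (D_u D_v m). *)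
Definition mixed_pde (u v : R2) (m psi : R2 -> R) : Prop :=
  distr_eq
    (distr_of (fun x => (1 + 2 * fst u ^ 2) * pd i1 (pd i1 psi) x
                        + (fst u ^ 2 - snd u ^ 2) * pd i2 (pd i2 psi) x))
    (distr_scal (- (1 / snd u))
       (distr_Xray e2 (distr_Dir u (distr_Dir v (distr_of m))))).

(* Main.v *)
Require Import Defs.
From Stdlib Require Import Reals Lra.
From Stdlib Require Import Classical ClassicalEpsilon FunctionalExtensionality.
From Coquelicot Require Import Coquelicot.
Open Scope R_scope.

(** For the three kinds of fields [f], contracting [f] with [u^2], [(u^perp)^2]
    or [u (.) u^perp] gives a second-order operator applied to [phi].  Except
    for the mixed transform of [d d^perp phi], this operator factors as
    [D_u D_a] for some vector [a], and likewise as [D_v D_b] along [v].  By the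
    fundamental theorem of calculus along a ray, [X_u (D_u g) = - g] for a
    compactly supported [g] ([Xray_Dir]), so the V-line transform is
    [- D_(a+b) phi].  As [v] is the mirror image of [u], the vector [a + b]
    is [2 u2 e1] or [2 u2 e2] up to sign, and one more integration along that
    axis returns a multiple of [phi] ([vline_reconstruction]).

    The mixed transform [m] of [d d^perp phi] is [X_u A_u + X_v A_v] with [A_u],
    [A_v] merely continuous, so [D_u D_v m] is only a distribution.  Paired with a
    test function [chi], it is handled by one integration-by-parts formula,
    [int (X_a A) (D_a chi) = int A chi] ([plane_int_Xray_Dir]), and by
    [int (d1 g) (d2 chi) = int (d2 g) (d1 chi)] ([plane_int_Dir_swap]), which
    together turn the pairing into [- u2 int E (d2 chi)], where
    [E = (1 + 2 u1^2) phi_11 + (u1^2 - u2^2) phi_22]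
    ([plane_int_Mvline_Dir_Dir]).  Translating [chi] along [e2] makes
    [int E (d2 chi)] a derivative in the translation parameter, so [X_(e2)]
    integrates it back to [int E chi] ([half_int_plane_int_Dir]); this is the
    differential equation.

    All integrations by parts rest on a divergence theorem for continuous
    compactly supported functions that are differentiable in one direction only
    ([plane_int_divergence]): the integral of [G (x + s a)] does not depend on
    [s], because each of the two one-variable integrals is translation invariant,
    hence the integral of its derivative in [s] vanishes.

    For uniqueness, two solutions have the same [E] because bump functions
    separate continuous functions ([distr_of_inj]), so their difference [w] solves
    [al w_11 + be w_22 = 0] with [al >= 1].  If [be <= 0] the operator is a product
    of two directional derivatives, each of which is injective on compactly
    supported functions by [Xray_Dir]; if [be > 0], the energy identity
    [int (al w_1^2 + be w_2^2) = 0] forces [w_1 = 0] ([second_order_eq_0]). *)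

(** * Continuity and integrals depending on a parameter *)

Definition continuousR2 (h : R2 -> R) : Prop := forall x : R2, continuous h x.

Lemma continuous_add {U : UniformSpace} (f g : U -> R) x :
  continuous f x -> continuous g x -> continuous (fun y => f y + g y) x.
Proof. exact (continuous_plus f g x). Qed.

Lemma continuous_sub {U : UniformSpace} (f g : U -> R) x :
  continuous f x -> continuous g x -> continuous (fun y => f y - g y) x.
Proof. exact (continuous_minus f g x). Qed.

Lemma continuous_neg {U : UniformSpace} (f : U -> R) x :
  continuous f x -> continuous (fun y => - f y) x.
Proof. exact (continuous_opp f x). Qed.

Lemma continuous_mul {U : UniformSpace} (f g : U -> R) x :
  continuous f x -> continuous g x -> continuous (fun y => f y * g y) x.
Proof. exact (continuous_mult f g x). Qed.

Lemma continuous_proj1 {U V W : UniformSpace} (f : U -> V * W) x :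
  continuous f x -> continuous (fun y => fst (f y)) x.
Proof.
intros H; apply (continuous_comp f fst); [exact H|].
destruct (f x); apply continuous_fst.
Qed.

Lemma continuous_proj2 {U V W : UniformSpace} (f : U -> V * W) x :
  continuous f x -> continuous (fun y => snd (f y)) x.
Proof.
intros H; apply (continuous_comp f snd); [exact H|].
destruct (f x); apply continuous_snd.
Qed.

Lemma continuous_pair {U : UniformSpace} (h : R2 -> R) (f g : U -> R) x :
  continuousR2 h -> continuous f x -> continuous g x ->
  continuous (fun y => h (f y, g y)) x.
Proof.
intros Hh Hf Hg; apply (continuous_comp_2 f g (fun a b => h (a, b))); auto.
apply continuous_ext with (f := h); [now intros []|apply Hh].
Qed.

Lemma continuousR2_comp {U : UniformSpace} (h : R2 -> R) (f : U -> R2) x :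
  continuousR2 h -> continuous f x -> continuous (fun y => h (f y)) x.
Proof. intros Hh Hf; apply (continuous_comp f h); auto. Qed.

Ltac cont :=
  unfold shift, R2 in *; cbn [fst snd] in *;
  repeat match goal with
  | |- forall _, _ => intro
  | |- continuousR2 _ => intro
  | |- continuous (fun y => ?c) _ => apply continuous_const
  | |- continuous (fun y => y) _ => apply continuous_id
  | |- continuous (fun y => _ + _) _ => apply continuous_add
  | |- continuous (fun y => _ - _) _ => apply continuous_sub
  | |- continuous (fun y => _ * _) _ => apply continuous_mul
  | |- continuous (fun y => - _) _ => apply continuous_neg
  | |- continuous (fun y => fst (@?f y)) _ => apply (continuous_proj1 f)
  | |- continuous (fun y => snd (@?f y)) _ => apply (continuous_proj2 f)
  | |- continuous fst _ => apply (continuous_proj1 (fun y => y))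
  | |- continuous snd _ => apply (continuous_proj2 (fun y => y))
  | |- continuous (fun y => ?h (_, _)) _ => apply (continuous_pair h)
  | |- continuous (fun y => ?h (@?f y)) _ => apply (continuousR2_comp h f)
  | H : continuousR2 ?h |- continuous ?h _ => apply H
  | _ => solve [eauto]
  end.

Lemma ex_RInt_cont (g : R -> R) (a b : R) :
  (forall t, continuous g t) -> ex_RInt g a b.
Proof. intros H; apply (ex_RInt_continuous (V := R_CompleteNormedModule)); auto. Qed.

(** The parameter ranges over any uniform space, so that the lemma serves both for
    one real parameter and for a point of the plane.  Joint continuity gives, around
    each [y], a neighbourhood of [t0] on which [K] oscillates little; compactness of
    [[a, b]] makes this neighbourhood uniform in [y]. *)
Lemma continuous_RInt_param {T : UniformSpace} (K : T -> R -> R) (a b : R) :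
  a <= b ->
  (forall p : T * R, continuous (fun q : T * R => K (fst q) (snd q)) p) ->
  forall t, continuous (fun t => RInt (K t) a b) t.
Proof.
intros Hab HK t0.
assert (Kc : forall t y, continuous (K t) y).
{ intros t y.
  apply (continuous_comp_2 (fun _ => t) (fun y => y) K); [cont|cont|apply HK]. }
assert (Kex : forall t, ex_RInt (K t) a b).
{ intros t; apply ex_RInt_cont; intros; apply Kc. }
apply filterlim_locally; intros eps.
(* The 1 added to the length keeps the denominator positive when a = b; the factor 2
   compares two values of K through a third one. *)
assert (He : 0 < eps / (2 * (b - a + 1))).
{ apply Rdiv_lt_0_compat; [apply eps|lra]. }
set (e := mkposreal _ He).
assert (Hd : forall y, exists d : posreal, forall t z,
   ball t0 d t -> ball y d z -> Rabs (K t z - K t0 y) < e).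
{ intros y.
  destruct (proj1 (filterlim_locally _ _) (HK (t0, y)) e) as [d Hd].
  exists d; intros t z Ht Hz; apply (Hd (t, z)); split; assumption. }
destruct (constructive_indefinite_description
  (fun delta : R -> posreal => forall y t z,
     ball t0 (delta y) t -> ball y (delta y) z -> Rabs (K t z - K t0 y) < e))
  as [delta Hdelta].
{ exists (fun y => proj1_sig (constructive_indefinite_description _ (Hd y))).
  intros y; apply (proj2_sig (constructive_indefinite_description _ (Hd y))). }
destruct (compactness_value_1d a b delta) as [d Hcov].
exists d; intros t Ht.
assert (Hclose : forall y, a <= y <= b -> Rabs (K t y - K t0 y) <= 2 * e).
{ intros y Hy; apply Rnot_lt_le; intros Hlt; apply (Hcov y Hy); intros (s & Hs & Hys & Hds).
  assert (H1 : Rabs (K t y - K t0 s) < e).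
  { apply Hdelta; [now apply ball_le with (1 := Hds)|exact Hys]. }
  assert (H2 : Rabs (K t0 y - K t0 s) < e).
  { apply Hdelta; [apply ball_center|exact Hys]. }
  revert Hlt H1 H2; unfold Rabs; repeat destruct Rcase_abs; lra. }
change (Rabs (RInt (K t) a b - RInt (K t0) a b) < eps).
rewrite <- (RInt_minus (V := R_CompleteNormedModule)) by auto.
apply Rle_lt_trans with ((b - a) * (2 * e)).
- apply abs_RInt_le_const; auto.
  apply (ex_RInt_minus (V := R_CompleteNormedModule)); auto.
- unfold e; simpl.
  replace ((b - a) * (2 * (eps / (2 * (b - a + 1)))))
    with (eps * ((b - a) / (b - a + 1))) by (field; lra).
  rewrite <- (Rmult_1_r eps) at 2; apply Rmult_lt_compat_l; [apply eps|].
  apply Rlt_div_l; lra.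
Qed.

(** Differentiation under the integral sign, phrased with an explicit derivative
    [f'] so that it can be iterated. *)
Lemma is_derive_RInt_cont (f f' : R -> R -> R) (a b : R) :
  (forall t y, is_derive (fun t => f t y) t (f' t y)) ->
  (forall p : R * R, continuous (fun q : R * R => f (fst q) (snd q)) p) ->
  (forall p : R * R, continuous (fun q : R * R => f' (fst q) (snd q)) p) ->
  forall t, is_derive (fun t => RInt (f t) a b) t (RInt (f' t) a b).
Proof.
intros Hd Hf Hf' t.
assert (HD : forall t y, Derive (fun z => f z y) t = f' t y).
{ intros; apply is_derive_unique, Hd. }
rewrite (RInt_ext (f' t) (fun y => Derive (fun u => f u y) t)) by (intros; now rewrite HD).
apply is_derive_RInt_param.
- apply filter_forall; intros s y _; eexists; apply Hd.
- intros y _; apply continuity_2d_pt_ext with f'; [intros; now rewrite HD|].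
  apply continuity_2d_pt_filterlim, (Hf' (t, y)).
- apply filter_forall; intros s; apply ex_RInt_cont; intros y.
  apply (continuous_comp_2 (fun _ => s) (fun y => y) f); [cont|cont|apply Hf].
Qed.

(** * Integrals over the line, a half-line and the plane *)

Definition line_int (g : R -> R) : R :=
  RInt_gen g (Rbar_locally m_infty) (Rbar_locally p_infty).

Lemma RInt_zero_on (g : R -> R) (a b : R) :
  (forall t, Rmin a b < t < Rmax a b -> g t = 0) -> is_RInt g a b 0.
Proof.
intros H; apply is_RInt_ext with (fun _ => 0); [intros; symmetry; auto|].
generalize (is_RInt_const (V := R_NormedModule) a b 0).
now change (scal (b - a) 0) with ((b - a) * 0); rewrite Rmult_0_r.
Qed.

Lemma is_RInt_gen_box (g : R -> R) (a b : R) :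
  a <= b -> (forall t, continuous g t) -> (forall t, t < a \/ b < t -> g t = 0) ->
  is_RInt_gen g (Rbar_locally m_infty) (Rbar_locally p_infty) (RInt g a b).
Proof.
intros Hab Hc H0 P HP.
exists (fun x => x < a) (fun y => b < y); [now exists a|now exists b|].
intros x y Hx Hy; exists (RInt g a b); split; [|now apply locally_singleton].
simpl.
replace (RInt g a b) with (plus 0 (plus (RInt g a b) 0) : R)
  by (unfold plus; simpl; ring).
apply (is_RInt_Chasles (V := R_NormedModule) g x a y);
  [|apply (is_RInt_Chasles (V := R_NormedModule) g a b y)].
- apply RInt_zero_on; intros t; rewrite Rmin_left, Rmax_right by lra.
  intros; apply H0; lra.
- now apply (RInt_correct (V := R_CompleteNormedModule)), ex_RInt_cont.
- apply RInt_zero_on; intros t; rewrite Rmin_left, Rmax_right by lra.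
  intros; apply H0; lra.
Qed.

Lemma line_int_box (g : R -> R) (a b : R) :
  a <= b -> (forall t, continuous g t) -> (forall t, t < a \/ b < t -> g t = 0) ->
  line_int g = RInt g a b.
Proof. intros; apply is_RInt_gen_unique; now apply is_RInt_gen_box. Qed.

Lemma line_int_translate (g : R -> R) (a b c : R) :
  a <= b -> (forall t, continuous g t) -> (forall t, t < a \/ b < t -> g t = 0) ->
  line_int (fun t => g (t + c)) = line_int g.
Proof.
intros Hab Hc H0.
rewrite (line_int_box g a b), (line_int_box _ (a - c) (b - c)); auto; try lra.
- generalize (RInt_comp_lin g 1 c (a - c) (b - c)); intros HR.
  replace (1 * (a - c) + c) with a in HR by ring.
  replace (1 * (b - c) + c) with b in HR by ring.
  rewrite <- HR by (apply ex_RInt_cont; auto).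
  apply RInt_ext; intros; unfold scal; simpl; unfold mult; simpl.
  rewrite !Rmult_1_l; reflexivity.
- intros t; apply (continuous_comp (fun t => t + c) g); [cont|auto].
- intros; apply H0; lra.
Qed.

(** Fundamental theorem of calculus on a half-line: the primitive vanishes at
    infinity, so only its value at 0 remains. *)
Lemma half_int_primitive (F g : R -> R) (N : R) :
  (forall t, is_derive F t (g t)) -> (forall t, continuous g t) ->
  (forall t, N < t -> F t = 0) ->
  is_RInt_gen g (at_point 0) (Rbar_locally p_infty) (- F 0).
Proof.
intros HF Hg HN P HP.
exists (fun x => x = 0) (fun y => N < y); [reflexivity|now exists N|].
intros x y -> Hy; exists (- F 0); split; [|now apply locally_singleton].
simpl; replace (- F 0) with (minus (F y) (F 0)); [|rewrite (HN y Hy)].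
- apply (is_RInt_derive (V := R_CompleteNormedModule)); auto.
- unfold minus, plus, opp; simpl; ring.
Qed.

(** The set of points off the square is open, so that the condition passes to
    partial derivatives without any regularity of [h]. *)
Definition bounded_supp (h : R2 -> R) : Prop :=
  exists M : R, 0 <= M /\
    forall x, M < Rabs (fst x) \/ M < Rabs (snd x) -> h x = 0.

Definition Cc (h : R2 -> R) : Prop := continuousR2 h /\ bounded_supp h.

(** Convertible with [distr_of]: [distr_of h psi] is [plane_int (fun x => h x * psi x)]. *)
Definition plane_int (h : R2 -> R) : R :=
  line_int (fun x1 => line_int (fun x2 => h (x1, x2))).

Lemma outside_interval M t : t < - M \/ M < t -> 0 <= M -> M < Rabs t.
Proof. intros [H|H] HM; unfold Rabs; destruct Rcase_abs; lra. Qed.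

Definition slices (M : R) (h : R2 -> R) : R -> R :=
  fun x1 => RInt (fun x2 => h (x1, x2)) (- M) M.

Lemma continuous_slices M h : 0 <= M -> continuousR2 h ->
  forall t, continuous (slices M h) t.
Proof. 
intros HM Hh; apply (continuous_RInt_param (fun x1 x2 => h (x1, x2))); [lra|].
cont.
Qed.

Lemma slices_supp M h :
  (forall x, M < Rabs (fst x) \/ M < Rabs (snd x) -> h x = 0) ->
  forall t, M < Rabs t -> slices M h t = 0.
Proof.
intros H t Ht; apply is_RInt_unique, RInt_zero_on; intros; apply H; now left.
Qed.

Lemma inner_int_box M h x1 : 0 <= M -> continuousR2 h ->
  (forall x, M < Rabs (fst x) \/ M < Rabs (snd x) -> h x = 0) ->
  line_int (fun x2 => h (x1, x2)) = slices M h x1.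
Proof.
intros HM Hc H; apply line_int_box; [lra|cont|].
intros t Ht; apply H; right; now apply outside_interval.
Qed.

Lemma plane_int_box M h : 0 <= M -> continuousR2 h ->
  (forall x, M < Rabs (fst x) \/ M < Rabs (snd x) -> h x = 0) ->
  plane_int h = RInt (slices M h) (- M) M.
Proof.
intros HM Hc H; unfold plane_int.
replace (fun x1 => line_int (fun x2 => h (x1, x2))) with (slices M h).
- apply line_int_box; [lra|now apply continuous_slices|].
  intros t Ht; apply slices_supp; [exact H|now apply outside_interval].
- apply functional_extensionality; intros x1; symmetry; now apply inner_int_box.
Qed.

(** The two one-variable integrals are translated separately. *)
Lemma plane_int_translate h b :
  Cc h -> plane_int (fun x => h (shift x 1 b)) = plane_int h.
Proof.
intros [Hc [M [HM H]]]; unfold plane_int.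
replace (fun x1 => line_int (fun x2 => h (shift (x1, x2) 1 b)))
  with (fun x1 => slices M h (x1 + 1 * fst b)).
- rewrite (line_int_translate (slices M h) (- M) M); [|lra|now apply continuous_slices|].
  + f_equal; apply functional_extensionality; intros x1; symmetry; now apply inner_int_box.
  + intros t Ht; apply slices_supp; [exact H|now apply outside_interval].
- apply functional_extensionality; intros x1; unfold shift; simpl.
  rewrite (line_int_translate (fun x2 => h (x1 + 1 * fst b, x2)) (- M) M); [|lra|cont|].
  + symmetry; now apply inner_int_box.
  + intros t Ht; apply H; right; now apply outside_interval.
Qed.

Lemma Cc_common_box f g : Cc f -> Cc g -> exists M, 0 <= M /\
  (forall x, M < Rabs (fst x) \/ M < Rabs (snd x) -> f x = 0) /\
  (forall x, M < Rabs (fst x) \/ M < Rabs (snd x) -> g x = 0).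
Proof.
intros [_ [M [HM Hf]]] [_ [N [HN Hg]]]; exists (M + N); split; [lra|split; intros x Hx].
- apply Hf; lra.
- apply Hg; lra.
Qed.

Lemma Cc_plus f g : Cc f -> Cc g -> Cc (fun x => f x + g x).
Proof.
intros Hf Hg; destruct (Cc_common_box f g Hf Hg) as (M & HM & H1 & H2).
split; [destruct Hf, Hg; cont|exists M; split; [exact HM|]].
intros x Hx; rewrite H1, H2 by exact Hx; ring.
Qed.

Lemma Cc_mult_r f g : Cc f -> continuousR2 g -> Cc (fun x => f x * g x).
Proof.
intros [Hf [M [HM H]]] Hg; split; [cont|exists M; split; [exact HM|]].
intros x Hx; rewrite H by exact Hx; ring.
Qed.

Lemma Cc_mult_l f g : continuousR2 f -> Cc g -> Cc (fun x => f x * g x).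
Proof.
intros Hg [Hf [M [HM H]]]; split; [cont|exists M; split; [exact HM|]].
intros x Hx; rewrite H by exact Hx; ring.
Qed.

Lemma Cc_scal c f : Cc f -> Cc (fun x => c * f x).
Proof. apply (Cc_mult_l (fun _ => c)); cont. Qed.

Lemma plane_int_plus f g : Cc f -> Cc g ->
  plane_int (fun x => f x + g x) = plane_int f + plane_int g.
Proof.
intros Hf Hg; destruct (Cc_common_box f g Hf Hg) as (M & HM & H1 & H2).
destruct Hf as [Hf _], Hg as [Hg _].
rewrite !(plane_int_box M); auto; [|cont|].
- rewrite <- (RInt_plus (V := R_CompleteNormedModule))
    by (apply ex_RInt_cont; intros; now apply continuous_slices).
  apply RInt_ext; intros x1 _; unfold slices.
  apply (RInt_plus (V := R_CompleteNormedModule) (fun x2 => f (x1, x2)) (fun x2 => g (x1, x2)));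
    apply ex_RInt_cont; cont.
- intros x Hx; rewrite H1, H2 by exact Hx; ring.
Qed.

Lemma RInt_scal_cont c (g : R -> R) a b : (forall t, continuous g t) ->
  RInt (fun t => c * g t) a b = c * RInt g a b.
Proof.
intros H; exact (RInt_scal (V := R_CompleteNormedModule) g a b c (ex_RInt_cont g a b H)).
Qed.

Lemma plane_int_scal c f : Cc f ->
  plane_int (fun x => c * f x) = c * plane_int f.
Proof.
intros [Hf [M [HM H]]].
rewrite !(plane_int_box M); auto; [|cont|].
- rewrite <- RInt_scal_cont by (intros; now apply continuous_slices).
  apply RInt_ext; intros x1 _; unfold slices; apply RInt_scal_cont; cont.
- intros x Hx; rewrite H by exact Hx; ring.
Qed.

Lemma plane_int_ext f g : (forall x, f x = g x) -> plane_int f = plane_int g.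
Proof. intros H; f_equal; now apply functional_extensionality. Qed.

(** Differentiation under the plane integral is differentiation under each
    one-variable integral over a fixed square; [P t] need only vanish off that
    square for [t] near [t0]. *)
Lemma is_derive_plane_int (P P' : R -> R2 -> R) (t0 M : R) :
  0 <= M ->
  (forall t x, is_derive (fun s => P s x) t (P' t x)) ->
  (forall p : R * R2, continuous (fun q : R * R2 => P (fst q) (snd q)) p) ->
  (forall p : R * R2, continuous (fun q : R * R2 => P' (fst q) (snd q)) p) ->
  (forall t x, Rabs (t - t0) < 1 -> M < Rabs (fst x) \/ M < Rabs (snd x) -> P t x = 0) ->
  (forall x, M < Rabs (fst x) \/ M < Rabs (snd x) -> P' t0 x = 0) ->
  is_derive (fun t => plane_int (P t)) t0 (plane_int (P' t0)).
Proof.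
intros HM HD HP HP' H0 H0'.
assert (Hcomp : forall (U : UniformSpace) (Q : R -> R2 -> R) (f g h : U -> R) x,
  (forall p : R * R2, continuous (fun q : R * R2 => Q (fst q) (snd q)) p) ->
  continuous f x -> continuous g x -> continuous h x ->
  continuous (fun u => Q (f u) (g u, h u)) x).
{ intros U Q f g h x HQ Hf Hg Hh.
  apply (continuous_comp_2 f (fun u => (g u, h u)) Q); [exact Hf| |apply HQ].
  apply (continuous_comp_2 g h (fun a b => (a, b))); auto.
  apply continuous_ext with (f := fun p => p); [now intros []|apply continuous_id]. }
assert (Hslice : forall Q : R -> R2 -> R,
  (forall p : R * R2, continuous (fun q : R * R2 => Q (fst q) (snd q)) p) ->
  forall p : R * R, continuous (fun q : R * R => slices M (Q (fst q)) (snd q)) p).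
{ intros Q HQ.
  apply (continuous_RInt_param (fun (q : R * R) x2 => Q (fst q) (snd q, x2))); [lra|].
  intros p; apply (Hcomp _ Q (fun q => fst (fst q)) (fun q => snd (fst q)) snd); auto; cont. }
assert (Hc : forall Q : R -> R2 -> R,
  (forall p : R * R2, continuous (fun q : R * R2 => Q (fst q) (snd q)) p) ->
  forall t, continuousR2 (Q t)).
{ intros Q HQ t x; apply (continuous_comp_2 (fun _ => t) (fun x => x) Q);
    [cont|cont|apply HQ]. }
rewrite (plane_int_box M) by auto.
apply is_derive_ext_loc with (fun t => RInt (slices M (P t)) (- M) M).
- exists (mkposreal 1 Rlt_0_1); intros t Ht; symmetry; apply plane_int_box; auto.
- apply (is_derive_RInt_cont (fun t => slices M (P t)) (fun t => slices M (P' t))).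
  + intros t x1.
    apply (is_derive_RInt_cont (fun s x2 => P s (x1, x2)) (fun s x2 => P' s (x1, x2))).
    * intros; apply HD.
    * intros p; apply (Hcomp _ P fst (fun _ => x1) snd); auto; cont.
    * intros p; apply (Hcomp _ P' fst (fun _ => x1) snd); auto; cont.
  + now apply Hslice.
  + now apply Hslice.
Qed.

Lemma shift_shift x s t a : shift (shift x s a) t a = shift x (t + s) a.
Proof. unfold shift; simpl; f_equal; ring. Qed.

Lemma shift_0 x a : shift x 0 a = x.
Proof. destruct x; unfold shift; simpl; f_equal; ring. Qed.

(** Differentiability along [a] at every base point and parameter 0 gives it at
    every parameter, since [shift] is an action of the reals. *)
Lemma is_derive_along (G H : R2 -> R) (a : R2) :
  (forall x, is_derive (fun s => G (shift x s a)) 0 (H x)) ->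
  forall x t, is_derive (fun s => G (shift x s a)) t (H (shift x t a)).
Proof.
intros HD x t.
assert (E : forall s : R, s - t + t = s) by (intros; ring).
apply is_derive_ext with (fun s => G (shift (shift x t a) (s - t) a)).
{ intros s; now rewrite shift_shift, E. }
replace (H (shift x t a)) with (scal 1 (H (shift x t a))) by apply Rmult_1_l.
apply (is_derive_comp (fun s => G (shift (shift x t a) s a)) (fun s => s - t)).
- rewrite Rminus_diag; apply HD.
- auto_derive; auto; ring.
Qed.

(** The integral of [G] is invariant under translation by [s a], so its derivative
    in [s] at 0 vanishes; by differentiation under the integral this derivative is
    the integral of [H].  [G] is only required to be differentiable along [a], because
    X-ray transforms of continuous functions are no better than that. *)
Lemma plane_int_divergence (G H : R2 -> R) (a : R2) :
  Cc G -> Cc H ->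
  (forall x, is_derive (fun s => G (shift x s a)) 0 (H x)) ->
  plane_int H = 0.
Proof.
intros HG HH HD.
destruct (Cc_common_box G H HG HH) as (M & HM & H1 & H2).
assert (HG' := HG); destruct HG as [HGc _], HH as [HHc _].
assert (D1 : is_derive (fun s => plane_int (fun x => G (shift x s a))) 0
               (plane_int (fun x => H (shift x 0 a)))).
{ assert (Habs := fun i => Rabs_pos (coord i a)).
  assert (Ha1 := Habs i1); assert (Ha2 := Habs i2); simpl in Ha1, Ha2.
  apply (is_derive_plane_int (fun s x => G (shift x s a)) (fun s x => H (shift x s a)) 0
    (M + Rabs (fst a) + Rabs (snd a))).
  - lra.
  - intros; now apply is_derive_along.
  - cont. 
  - cont. 
  - intros t x Ht Hx; apply H1; unfold shift; simpl.
    rewrite Rminus_0_r in Ht.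
    assert (Hk : forall y b, Rabs y <= Rabs (y + t * b) + Rabs b).
    { intros y b; replace y with ((y + t * b) + - (t * b)) at 1 by ring.
      eapply Rle_trans; [apply Rabs_triang|]; rewrite Rabs_Ropp, Rabs_mult.
      apply Rplus_le_compat_l; rewrite <- (Rmult_1_l (Rabs b)) at 2.
      apply Rmult_le_compat_r; [apply Rabs_pos|lra]. }
    assert (K1 := Hk (fst x) (fst a)); assert (K2 := Hk (snd x) (snd a)).
    destruct Hx; [left|right]; lra.
  - intros x Hx; rewrite shift_0; apply H2; destruct Hx; [left|right]; lra. }
rewrite (plane_int_ext _ H) in D1 by (intros; now rewrite shift_0).
(* By translation invariance this function of s is constant. *)
assert (D2 : is_derive (fun s => plane_int (fun x => G (shift x s a))) 0 0).
{ apply is_derive_ext with (fun _ => plane_int G).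
  - intros s; rewrite <- (plane_int_translate G (s * fst a, s * snd a)) by exact HG'.
    apply plane_int_ext; intros x; unfold shift; simpl; do 2 f_equal; ring.
  - apply (is_derive_const (V := R_NormedModule)). }
rewrite <- (is_derive_unique _ _ _ D1); now apply is_derive_unique.
Qed.

(** By continuity [g] stays positive on a small interval around [t0], and
    elsewhere it contributes a nonnegative amount. *)
Lemma RInt_pos_point (g : R -> R) (a b t0 : R) :
  (forall t, continuous g t) -> (forall t, 0 <= g t) -> a < t0 < b -> 0 < g t0 ->
  0 < RInt g a b.
Proof.
intros Hc Hp Ht Hg.
destruct (proj1 (filterlim_locally _ _) (Hc t0) (mkposreal _ Hg)) as [d Hd].
(* Halving keeps [t0 - c, t0 + c] strictly inside both (a, b) and the ball of radius d. *)
set (c := Rmin d (Rmin (t0 - a) (b - t0)) / 2).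
assert (Hc0 : 0 < c /\ c < d /\ c < t0 - a /\ c < b - t0).
{ assert (Hd0 := cond_pos d).
  unfold c; unfold Rmin; repeat destruct Rle_dec; repeat split; lra. }
assert (Hex : forall x y, ex_RInt g x y) by (intros; apply ex_RInt_cont; auto).
rewrite <- (RInt_Chasles g a (t0 - c) b), <- (RInt_Chasles g (t0 - c) (t0 + c) b) by auto.
assert (0 <= RInt g a (t0 - c)) by (apply RInt_ge_0; auto; lra).
assert (0 <= RInt g (t0 + c) b) by (apply RInt_ge_0; auto; lra).
assert (0 < RInt g (t0 - c) (t0 + c)).
{ apply RInt_gt_0; auto; [lra|]; intros x Hx.
  assert (Hb : ball t0 d x)
    by (change (Rabs (x - t0) < d); unfold Rabs; destruct Rcase_abs; lra).
  specialize (Hd x Hb); change (Rabs (g x - g t0) < g t0) in Hd.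
  revert Hd; unfold Rabs; destruct Rcase_abs; lra. }
unfold plus; simpl; lra.
Qed.

(** At a point where [h] is positive, so is its slice, and hence the integral of
    the slices. *)
Lemma plane_int_eq_0 h : Cc h -> (forall x, 0 <= h x) -> plane_int h = 0 ->
  forall x, h x = 0.
Proof.
intros [Hc [M [HM H]]] Hp HI x.
destruct (Req_dec (h x) 0) as [|Hx]; [assumption|exfalso].
assert (Hx' : 0 < h x) by (destruct (Hp x); [assumption|congruence]).
assert (Hsmall : Rabs (fst x) <= M /\ Rabs (snd x) <= M).
{ split; apply Rnot_lt_le; intros Hlt; apply Hx, H; auto. }
assert (Hin : forall y, Rabs y <= M -> - (M + 1) < y < M + 1).
{ intros y; unfold Rabs; destruct Rcase_abs; lra. }
(* The larger square has x in its interior, as RInt_pos_point requires. *)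
rewrite (plane_int_box (M + 1)) in HI; [|lra|exact Hc|].
- revert HI; apply Rgt_not_eq, (RInt_pos_point _ _ _ (fst x)).
  + apply continuous_slices; [lra|exact Hc].
  + intros t; apply RInt_ge_0; [lra|apply ex_RInt_cont; cont|auto].
  + apply Hin, Hsmall.
  + apply (RInt_pos_point _ _ _ (snd x)); [cont|auto|apply Hin, Hsmall|].
    now destruct x.
- intros y Hy; apply H; destruct Hy; [left|right]; lra.
Qed.

(** * Calculus of functions of class C^k on the plane *)

Lemma Ck_continuous k h : Ck k h -> continuousR2 h.
Proof. destruct k; intros [H _]; exact H. Qed.

Lemma Ck_pd k i h : Ck (S k) h -> Ck k (pd i h).
Proof. intros [_ H]; apply H. Qed.

Lemma Ck_ex_pd k i h x : Ck (S k) h -> ex_pd i h x.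
Proof. intros [_ H]; apply H. Qed.

Lemma Ck_S k h : Ck (S k) h -> Ck k h.
Proof.
revert h; induction k as [|k IH]; intros h H.
- split; [apply H|exact I].
- split; [apply H|]; intros i; split; [apply (proj2 H i)|apply IH, Ck_pd, H].
Qed.

Lemma pd_const c i x : pd i (fun _ => c) x = 0.
Proof. destruct i; exact (Derive_const c _). Qed.

Lemma Ck_const k c : Ck k (fun _ => c).
Proof.
revert c; induction k as [|k IH]; intros c; (split; [cont|]); [exact I|].
intros i; split; [intros x; destruct i; apply (ex_derive_const (V := R_NormedModule) c)|].
replace (pd i (fun _ => c)) with (fun _ : R2 => 0); [apply IH|].
apply functional_extensionality; intros x; now rewrite pd_const.
Qed.

Lemma pd_plus i f g x : ex_pd i f x -> ex_pd i g x ->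
  pd i (fun y => f y + g y) x = pd i f x + pd i g x.
Proof. destruct i; intros; now apply Derive_plus. Qed.

Lemma pd_mult i f g x : ex_pd i f x -> ex_pd i g x ->
  pd i (fun y => f y * g y) x = pd i f x * g x + f x * pd i g x.
Proof. destruct x, i; intros Hf Hg; exact (Derive_mult _ _ _ Hf Hg). Qed.

Lemma Ck_plus k f g : Ck k f -> Ck k g -> Ck k (fun x => f x + g x).
Proof.
revert f g; induction k as [|k IH]; intros f g Hf Hg;
  assert (Hf0 := Ck_continuous _ _ Hf); assert (Hg0 := Ck_continuous _ _ Hg);
  (split; [cont|]); [exact I|].
intros i; assert (Hf1 := fun x => Ck_ex_pd k i f x Hf); assert (Hg1 := fun x => Ck_ex_pd k i g x Hg).
split.
- intros x; specialize (Hf1 x); specialize (Hg1 x).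
  destruct i; apply (ex_derive_plus (V := R_NormedModule)); assumption.
- replace (pd i (fun x => f x + g x)) with (fun x => pd i f x + pd i g x).
  + apply IH; now apply Ck_pd.
  + apply functional_extensionality; intros x; now rewrite pd_plus.
Qed.

(** Leibniz' rule expresses the partial derivatives of a product through products
    of functions that are one class less regular. *)
Lemma Ck_mult k f g : Ck k f -> Ck k g -> Ck k (fun x => f x * g x).
Proof.
revert f g; induction k as [|k IH]; intros f g Hf Hg;
  assert (Hf0 := Ck_continuous _ _ Hf); assert (Hg0 := Ck_continuous _ _ Hg);
  (split; [cont|]); [exact I|].
intros i; assert (Hf1 := fun x => Ck_ex_pd k i f x Hf); assert (Hg1 := fun x => Ck_ex_pd k i g x Hg).
split.
- intros x; specialize (Hf1 x); specialize (Hg1 x).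
  destruct i; apply ex_derive_mult; assumption.
- replace (pd i (fun x => f x * g x)) with (fun x => pd i f x * g x + f x * pd i g x).
  + apply Ck_plus; apply IH; try (now apply Ck_pd); now apply Ck_S.
  + apply functional_extensionality; intros x; now rewrite pd_mult.
Qed.

Lemma Ck_scal k c f : Ck k f -> Ck k (fun x => c * f x).
Proof. apply Ck_mult, Ck_const. Qed.

Lemma pd_scal i c f x : ex_pd i f x -> pd i (fun y => c * f y) x = c * pd i f x.
Proof. destruct i; intros; apply Derive_scal. Qed.

Lemma Ck_Dir k a h : Ck (S k) h -> Ck k (Dir a h).
Proof. intros H; apply Ck_plus; apply Ck_scal, Ck_pd, H. Qed.

Lemma pd_Dir i a h x : Ck 2 h ->
  pd i (Dir a h) x = fst a * pd i (pd i1 h) x + snd a * pd i (pd i2 h) x.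
Proof.
intros H; assert (H1 : forall j, ex_pd i (pd j h) x) by (intros; now apply (Ck_ex_pd 0), Ck_pd).
assert (H2 : forall c j, ex_pd i (fun y => c * pd j h y) x).
{ intros c j; now apply (Ck_ex_pd 0), Ck_scal, Ck_pd. }
unfold Dir; rewrite pd_plus, !pd_scal; auto.
Qed.

Lemma pd_comm h x : Ck 2 h -> pd i1 (pd i2 h) x = pd i2 (pd i1 h) x.
Proof.
intros H; destruct x as [x y].
apply (Schwarz (fun a b => h (a, b)) x y).
- apply locally_2d_locally, filter_forall; intros [a b]; simpl; repeat split.
  + apply (Ck_ex_pd 1 i1 h (a, b) H).
  + apply (Ck_ex_pd 1 i2 h (a, b) H).
  + apply (Ck_ex_pd 0 i1 (pd i2 h) (a, b)), Ck_pd, H.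
  + apply (Ck_ex_pd 0 i2 (pd i1 h) (a, b)), Ck_pd, H.
- assert (C := Ck_continuous 0 _ (Ck_pd _ i1 _ (Ck_pd _ i2 _ H))).
  apply continuity_2d_pt_filterlim, (C (x, y)).
- assert (C := Ck_continuous 0 _ (Ck_pd _ i2 _ (Ck_pd _ i1 _ H))).
  apply continuity_2d_pt_filterlim, (C (x, y)).
Qed.

(** Existence and continuity of the partial derivatives imply differentiability,
    after which the chain rule applies. *)
Lemma is_derive_Dir h a x : Ck 1 h ->
  is_derive (fun s => h (shift x s a)) 0 (Dir a h x).
Proof.
intros H; destruct x as [x y]; apply is_derive_Reals.
replace (Dir a h (x, y)) with (pd i1 h (x, y) * fst a + pd i2 h (x, y) * snd a)
  by (unfold Dir; ring).
apply (derivable_pt_lim_comp_2d (fun a b => h (a, b))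
  (fun s => x + s * fst a) (fun s => y + s * snd a)).
- rewrite !Rmult_0_l, !Rplus_0_r; apply filterdiff_differentiable_pt_lim.
  apply (is_derive_filterdiff (fun a b => h (a, b)) x y (fun a b => pd i1 h (a, b))).
  + apply filter_forall; intros [p q].
    apply (Derive_correct (fun z => h (z, q))), (Ck_ex_pd 0 i1 h (p, q) H).
  + apply (Derive_correct (fun z => h (x, z))), (Ck_ex_pd 0 i2 h (x, y) H).
  + assert (C := Ck_continuous 0 _ (Ck_pd _ i1 _ H)); cont.
- apply is_derive_Reals; auto_derive; auto; ring.
- apply is_derive_Reals; auto_derive; auto; ring.
Qed.

Lemma is_derive_pd_shift i h t b x : Ck 1 h ->
  match i with
  | i1 => is_derive (fun z => h (shift (z, snd x) t b)) (fst x) (pd i h (shift x t b))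
  | i2 => is_derive (fun z => h (shift (fst x, z) t b)) (snd x) (pd i h (shift x t b))
  end.
Proof.
intros H; destruct i.
- assert (E := Derive_correct _ _ (Ck_ex_pd 0 i1 h (shift x t b) H)); simpl in E.
  replace (pd i1 h (shift x t b)) with (scal 1 (pd i1 h (shift x t b))) by apply Rmult_1_l.
  apply (is_derive_comp (fun z => h (z, snd x + t * snd b)) (fun z => z + t * fst b)); [exact E|].
  auto_derive; auto.
- assert (E := Derive_correct _ _ (Ck_ex_pd 0 i2 h (shift x t b) H)); simpl in E.
  replace (pd i2 h (shift x t b)) with (scal 1 (pd i2 h (shift x t b))) by apply Rmult_1_l.
  apply (is_derive_comp (fun z => h (fst x + t * fst b, z)) (fun z => z + t * snd b)); [exact E|].
  auto_derive; auto.
Qed.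

Lemma pd_shift i h t b : Ck 1 h ->
  pd i (fun y => h (shift y t b)) = (fun y => pd i h (shift y t b)).
Proof.
intros H; apply functional_extensionality; intros x.
assert (E := is_derive_pd_shift i h t b x H).
destruct i; now apply is_derive_unique.
Qed.

Lemma Ck_shift k h t b : Ck k h -> Ck k (fun y => h (shift y t b)).
Proof.
revert h; induction k as [|k IH]; intros h H; assert (H0 := Ck_continuous _ _ H);
  (split; [cont|]); [exact I|].
assert (H1 : Ck 1 h) by (clear - H; induction k; auto; apply IHk, Ck_S, H).
intros i; split.
- intros x; assert (E := is_derive_pd_shift i h t b x H1); destruct i; eexists; apply E.
- rewrite pd_shift by exact H1; apply IH, Ck_pd, H.
Qed.

Lemma Dir_shift a h t b : Ck 1 h ->
  Dir a (fun y => h (shift y t b)) = (fun y => Dir a h (shift y t b)).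
Proof. intros H; unfold Dir; now rewrite !pd_shift. Qed.

Lemma Dir_comm a b h : Ck 2 h -> Dir a (Dir b h) = Dir b (Dir a h).
Proof.
intros H; apply functional_extensionality; intros x.
unfold Dir at 1 3; rewrite !pd_Dir, (pd_comm h x) by exact H; ring.
Qed.

(** Off the square, the function vanishes on a neighbourhood. *)
Lemma bounded_supp_pd i h : bounded_supp h -> bounded_supp (pd i h).
Proof.
intros [M [HM H]]; exists M; split; [exact HM|]; intros [x y] Hx; simpl in Hx.
assert (Hopen : forall t, M < Rabs t -> locally t (fun s => M < Rabs s)).
{ intros t Ht; apply (open_comp Rabs (fun s => M < s)); [|apply open_gt|exact Ht].
  intros; apply continuous_Rabs. }
destruct i; simpl; destruct Hx as [Hx|Hx].
- rewrite (Derive_ext_loc _ (fun _ => 0)); [apply Derive_const|].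
  generalize (Hopen _ Hx); apply filter_imp; intros; apply H; now left.
- rewrite (Derive_ext _ (fun _ => 0)); [apply Derive_const|].
  intros; apply H; now right.
- rewrite (Derive_ext _ (fun _ => 0)); [apply Derive_const|].
  intros; apply H; now left.
- rewrite (Derive_ext_loc _ (fun _ => 0)); [apply Derive_const|].
  generalize (Hopen _ Hx); apply filter_imp; intros; apply H; now right.
Qed.

Lemma Cc_pd k i h : Ck (S k) h -> bounded_supp h -> Cc (pd i h).
Proof. intros H1 H2; split; [eapply Ck_continuous, Ck_pd, H1|now apply bounded_supp_pd]. Qed.

Lemma Cc_Dir k a h : Ck (S k) h -> bounded_supp h -> Cc (Dir a h).
Proof. intros H1 H2; apply Cc_plus; apply Cc_scal; eapply Cc_pd; eauto. Qed.

Lemma bounded_supp_Dir k a h : Ck (S k) h -> bounded_supp h -> bounded_supp (Dir a h).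
Proof. intros H1 H2; now apply (Cc_Dir k). Qed.

Lemma supp_disc_bounded r h : (forall x, supp h x -> Defs.disc r x) -> bounded_supp h.
Proof.
intros H; exists (Rabs r); split; [apply Rabs_pos|]; intros x Hx.
cut (locally x (fun y => h y = 0)); [apply (locally_singleton x (fun y : R * R => h y = 0))|apply NNPP; intros Hs].
apply H in Hs; unfold Defs.disc in Hs.
assert (Hsq : forall a b : R, Rabs a < Rabs b -> a ^ 2 < b ^ 2).
{ intros a b Hab; rewrite <- (pow2_abs a), <- (pow2_abs b).
  assert (Ha := Rabs_pos a); nra. }
assert (H1 := pow2_ge_0 (fst x)); assert (H2 := pow2_ge_0 (snd x)).
destruct Hx as [Hx|Hx]; apply Hsq in Hx; lra.
Qed.

(** * X-ray transforms and integration by parts *)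

Definition nonzero_vec (a : R2) : Prop := fst a <> 0 \/ snd a <> 0.

(** Leaving the square takes a time of at most [(M + B) / |a_i|] for a nonzero
    component [a_i], uniformly over starting points in the square of half-side [B]. *)
Lemma ray_escapes a M B : nonzero_vec a -> 0 <= M + B -> exists N, 0 <= N /\
  forall x t, Rabs (fst x) <= B -> Rabs (snd x) <= B -> N < t ->
    M < Rabs (fst (shift x t a)) \/ M < Rabs (snd (shift x t a)).
Proof.
intros Ha HMB.
assert (Hk : forall c y t, c <> 0 -> Rabs y <= B -> (M + B) / Rabs c < t ->
  M < Rabs (y + t * c)).
{ intros c y t Hc Hy Ht.
  assert (Hc' := Rabs_pos_lt c Hc).
  apply Rlt_div_l in Ht; [|exact Hc'].
  assert (Ht' : Rabs (t * c) <= Rabs (y + t * c) + Rabs y).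
  { replace (t * c) with ((y + t * c) + - y) at 1 by ring.
    eapply Rle_trans; [apply Rabs_triang|]; rewrite Rabs_Ropp; lra. }
  rewrite Rabs_mult in Ht'.
  assert (t * Rabs c <= Rabs t * Rabs c)
    by (apply Rmult_le_compat_r; [lra|apply Rle_abs]).
  lra. }
destruct Ha as [Ha|Ha].
- exists ((M + B) / Rabs (fst a)); split.
  + apply Rdiv_le_0_compat; [exact HMB|now apply Rabs_pos_lt].
  + intros x t H1 H2 Ht; left; now apply Hk.
- exists ((M + B) / Rabs (snd a)); split.
  + apply Rdiv_le_0_compat; [exact HMB|now apply Rabs_pos_lt].
  + intros x t H1 H2 Ht; right; now apply Hk.
Qed.

(** [Dir a g] is the derivative of [g] along the ray, and [g] vanishes far out. *)
Lemma half_int_Dir a g x : nonzero_vec a -> Ck 1 g -> bounded_supp g ->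
  is_RInt_gen (fun t => Dir a g (shift x t a)) (at_point 0) (Rbar_locally p_infty) (- g x).
Proof.
intros Ha Hg [M [HM H]].
assert (P1 := Rabs_pos (fst x)); assert (P2 := Rabs_pos (snd x)).
destruct (ray_escapes a M (Rabs (fst x) + Rabs (snd x)) Ha) as [N [_ HN]]; [lra|].
replace (g x) with (g (shift x 0 a)) by now rewrite shift_0.
apply (half_int_primitive (fun t => g (shift x t a)) _ N).
- intros t; apply is_derive_along; intros y; now apply is_derive_Dir.
- assert (C := Ck_continuous 0 _ (Ck_Dir 0 a g Hg)); cont.
- intros t Ht; apply H, HN; lra.
Qed.

Lemma half_int_unique g l :
  is_RInt_gen g (at_point 0) (Rbar_locally p_infty) l -> half_int g = l.
Proof. exact (is_RInt_gen_unique (V := R_CompleteNormedModule) g l). Qed.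

Lemma Xray_Dir a g x : nonzero_vec a -> Ck 1 g -> bounded_supp g ->
  Xray a (Dir a g) x = - g x.
Proof. intros; apply half_int_unique; now apply half_int_Dir. Qed.

Lemma half_int_finite (g : R -> R) (N : R) : 0 <= N ->
  (forall t, continuous g t) -> (forall t, N < t -> g t = 0) ->
  half_int g = RInt g 0 N.
Proof.
intros HN Hc H0; apply half_int_unique; intros P HP.
exists (fun x => x = 0) (fun y => N < y); [reflexivity|now exists N|].
intros x y -> Hy; exists (RInt g 0 N); split; [|now apply locally_singleton].
simpl; replace (RInt g 0 N) with (plus (RInt g 0 N) 0 : R)
  by (unfold plus; simpl; ring).
apply (is_RInt_Chasles (V := R_NormedModule) g 0 N y).
- now apply (RInt_correct (V := R_CompleteNormedModule)), ex_RInt_cont.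
- apply RInt_zero_on; intros t; rewrite Rmin_left, Rmax_right by lra.
  intros; apply H0; lra.
Qed.

(** On a bounded set of base points, the X-ray transform is an integral over one
    fixed interval, to which the results on proper parametric integrals apply. *)
Lemma Xray_local a A B : nonzero_vec a -> Cc A -> 0 <= B -> exists N, 0 <= N /\
  forall x, Rabs (fst x) <= B -> Rabs (snd x) <= B ->
    (forall t, N < t -> A (shift x t a) = 0) /\
    Xray a A x = RInt (fun t => A (shift x t a)) 0 N.
Proof.
intros Ha [Hc [M [HM H]]] HB.
destruct (ray_escapes a M B Ha) as [N [HN0 HN]]; [lra|].
exists N; split; [exact HN0|]; intros x H1 H2.
assert (H3 : forall t, N < t -> A (shift x t a) = 0) by (intros; apply H, HN; auto).
split; [exact H3|]; apply half_int_finite; auto; cont.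
Qed.

Lemma continuous_Xray a A : nonzero_vec a -> Cc A -> continuousR2 (Xray a A).
Proof.
intros Ha HA x.
assert (P1 := Rabs_pos (fst x)); assert (P2 := Rabs_pos (snd x)).
destruct (Xray_local a A (Rabs (fst x) + Rabs (snd x) + 1) Ha HA) as (N & HN & H); [lra|].
apply continuous_ext_loc with (fun y => RInt (fun t => A (shift y t a)) 0 N).
- exists (mkposreal 1 Rlt_0_1); intros [y1 y2] [Hy1 Hy2].
  change (Rabs (y1 - fst x) < 1) in Hy1; change (Rabs (y2 - snd x) < 1) in Hy2.
  assert (T1 := Rabs_triang_inv y1 (fst x)); assert (T2 := Rabs_triang_inv y2 (snd x)).
  symmetry; apply H; simpl; lra.
- destruct HA as [HA _].
  apply (continuous_RInt_param (fun (y : R * R) t => A (shift y t a))); [exact HN|cont].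
Qed.

(** Moving the base point along the ray by [s] replaces the integral over
    [[0, oo)] by the integral over [[s, oo)], whose derivative in the lower bound
    is minus the integrand. *)
Lemma is_derive_Xray a A x : nonzero_vec a -> Cc A ->
  is_derive (fun s => Xray a A (shift x s a)) 0 (- A x).
Proof.
intros Ha HA.
assert (P1 := Rabs_pos (fst x)); assert (P2 := Rabs_pos (snd x)).
assert (P3 := Rabs_pos (fst a)); assert (P4 := Rabs_pos (snd a)).
destruct (Xray_local a A (Rabs (fst x) + Rabs (snd x) + Rabs (fst a) + Rabs (snd a)) Ha HA)
  as (N & HN & H); [lra|].
destruct HA as [HA _].
set (g := fun t => A (shift x t a)).
assert (Hg : forall t, continuous g t) by (unfold g; cont).
apply is_derive_ext_loc with (fun s => RInt g s (N + 1)).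
- exists (mkposreal 1 Rlt_0_1); intros s Hs.
  change (Rabs (s - 0) < 1) in Hs; rewrite Rminus_0_r in Hs.
  assert (Hb : forall y b, Rabs (y + s * b) <= Rabs y + Rabs b).
  { intros y b; eapply Rle_trans; [apply Rabs_triang|]; apply Rplus_le_compat_l.
    rewrite Rabs_mult; rewrite <- (Rmult_1_l (Rabs b)) at 2.
    apply Rmult_le_compat_r; [apply Rabs_pos|lra]. }
  destruct (H (shift x s a)) as [H0 ->].
  { specialize (Hb (fst x) (fst a)); simpl; lra. }
  { specialize (Hb (snd x) (snd a)); simpl; lra. }
  rewrite (RInt_ext (fun t => A (shift (shift x s a) t a)) (fun t => g (t + s)))
    by (intros; unfold g; now rewrite shift_shift).
  assert (E := RInt_comp_lin g 1 s 0 N (ex_RInt_cont g _ _ Hg)).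
  rewrite (RInt_ext (fun t => scal 1 (g (1 * t + s))) (fun t => g (t + s))) in E.
  2:{ intros; now rewrite !Rmult_1_l. }
  rewrite E, Rmult_0_r, Rplus_0_l, Rmult_1_l.
  rewrite <- (RInt_Chasles g s (N + s) (N + 1)) by now apply ex_RInt_cont.
  rewrite (is_RInt_unique g (N + s) (N + 1) 0); [unfold plus; simpl; ring|].
  apply RInt_zero_on; intros t; rewrite Rmin_left.
  2:{ revert Hs; unfold Rabs; destruct Rcase_abs; lra. }
  intros [Ht _]; specialize (H0 (t - s)); rewrite shift_shift in H0.
  replace (t - s + s) with t in H0 by ring; apply H0; lra.
- assert (Eg : g 0 = A x) by (unfold g; now rewrite shift_0).
  rewrite <- Eg.
  apply (is_derive_RInt' g (fun s => RInt g s (N + 1)) 0 (N + 1)); [|apply Hg].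
  apply filter_forall; intros; apply (RInt_correct (V := R_CompleteNormedModule)).
  now apply ex_RInt_cont.
Qed.

Lemma Cc_Ck k h : Ck k h -> bounded_supp h -> Cc h.
Proof. intros H1 H2; split; [eapply Ck_continuous, H1|exact H2]. Qed.

(** Divergence theorem for [(X_a A) chi], whose derivative along [a] is
    [- A chi + (X_a A) (D_a chi)].  It moves a distributional derivative of an X-ray
    transform to the density [A] although [A] is only continuous. *)
Lemma plane_int_Xray_Dir a A chi : nonzero_vec a -> Cc A -> Ck 1 chi -> bounded_supp chi ->
  plane_int (fun x => Xray a A x * Dir a chi x) = plane_int (fun x => A x * chi x).
Proof.
intros Ha HA Hchi Hs.
assert (HX := continuous_Xray a A Ha HA).
assert (C1 : Cc (fun x => Xray a A x * Dir a chi x))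
  by (apply Cc_mult_l; [exact HX|now apply (Cc_Dir 0)]).
assert (C2 : Cc (fun x => A x * chi x))
  by (apply Cc_mult_r; [exact HA|now apply (Ck_continuous 1)]).
assert (E : plane_int (fun x => Xray a A x * Dir a chi x + -1 * (A x * chi x)) = 0).
{ apply (plane_int_divergence (fun x => Xray a A x * chi x) _ a).
  - apply Cc_mult_l; [exact HX|now apply (Cc_Ck 1)].
  - apply Cc_plus; [exact C1|now apply Cc_scal].
  - intros x.
    assert (D1 := is_derive_Xray a A x Ha HA); assert (D2 := is_derive_Dir chi a x Hchi).
    assert (D := is_derive_mult _ _ _ _ _ D1 D2 Rmult_comm).
    cbv beta in D; rewrite !shift_0 in D.
    replace (Xray a A x * Dir a chi x + -1 * (A x * chi x))
      with (plus (mult (- A x) (chi x)) (mult (Xray a A x) (Dir a chi x)));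
      [exact D|unfold plus, mult; simpl; ring]. }
rewrite plane_int_plus, plane_int_scal in E; auto; [lra|now apply Cc_scal].
Qed.

(** Divergence theorem for the product [f g]. *)
Lemma plane_int_parts a f g : Ck 1 f -> Ck 1 g -> bounded_supp f -> bounded_supp g ->
  plane_int (fun x => Dir a f x * g x) = - plane_int (fun x => f x * Dir a g x).
Proof.
intros Hf Hg Sf Sg.
assert (C1 : Cc (fun x => Dir a f x * g x))
  by (apply Cc_mult_r; [now apply (Cc_Dir 0)|now apply (Ck_continuous 1)]).
assert (C2 : Cc (fun x => f x * Dir a g x))
  by (apply Cc_mult_l; [now apply (Ck_continuous 1)|now apply (Cc_Dir 0)]).
assert (E : plane_int (fun x => Dir a f x * g x + f x * Dir a g x) = 0).
{ apply (plane_int_divergence (fun x => f x * g x) _ a).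
  - apply Cc_mult_r; [now apply (Cc_Ck 1)|now apply (Ck_continuous 1)].
  - now apply Cc_plus.
  - intros x.
    assert (D1 := is_derive_Dir f a x Hf); assert (D2 := is_derive_Dir g a x Hg).
    assert (D := is_derive_mult _ _ _ _ _ D1 D2 Rmult_comm).
    cbv beta in D; rewrite !shift_0 in D; exact D. }
rewrite plane_int_plus in E; auto; lra.
Qed.

(** * V-line transforms that factor through a directional derivative *)

Definition opp_vec (a : R2) : R2 := (- fst a, - snd a).

Lemma pd_opp i h x : pd i (fun y => - h y) x = - pd i h x.
Proof. destruct i; apply Derive_opp. Qed.

Lemma Dir_Dir a b h x : Ck 2 h ->
  Dir a (Dir b h) x = fst a * fst b * pd i1 (pd i1 h) x
    + (fst a * snd b + snd a * fst b) * pd i2 (pd i1 h) x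
    + snd a * snd b * pd i2 (pd i2 h) x.
Proof. intros H; unfold Dir at 1; rewrite !pd_Dir, (pd_comm h x H) by exact H; ring. Qed.

Lemma inner_d_grad phi a b : Ck 2 phi ->
  inner (sym_d (grad phi)) (odot a b) = Dir a (Dir b phi).
Proof.
intros H; apply functional_extensionality; intros x.
rewrite Dir_Dir by exact H.
unfold inner, sym_d, grad, odot; simpl coord; rewrite (pd_comm phi x H); field.
Qed.

(** The tensor [(d^perp)^2 phi] is the Hessian conjugated by the quarter turn, so
    contracting it with rotated vectors gives derivatives along the vectors
    themselves; [opp_vec (perp b)] is [b] rotated back. *)
Lemma inner_d_perp_grad_perp phi a b : Ck 2 phi ->
  inner (sym_d_perp (grad_perp phi)) (odot (perp a) b) = Dir a (Dir (opp_vec (perp b)) phi).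
Proof.
intros H; apply functional_extensionality; intros x.
rewrite Dir_Dir by exact H.
unfold inner, sym_d_perp, grad_perp, odot, opp_vec, perp; cbn [coord fst snd sgn other].
change (fun x0 => pd i1 phi x0) with (pd i1 phi).
rewrite !pd_opp, (pd_comm phi x H); field.
Qed.

(** The gradient of [phi] is rotated by [d^perp], so [b . d^perp phi] is the
    derivative of [phi] along [b] rotated back; symmetrizing in [a] and [b] gives the
    two terms. *)
Lemma inner_d_grad_perp phi a b : Ck 2 phi ->
  inner (sym_d (grad_perp phi)) (odot a b) =
  fun x => / 2 * (Dir a (Dir (opp_vec (perp b)) phi) x + Dir b (Dir (opp_vec (perp a)) phi) x).
Proof.
intros H; apply functional_extensionality; intros x.
rewrite !Dir_Dir by exact H.
unfold inner, sym_d, grad_perp, odot, opp_vec, perp; cbn [coord fst snd].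
change (fun x0 => pd i1 phi x0) with (pd i1 phi).
rewrite !pd_opp, (pd_comm phi x H); field.
Qed.

Lemma odot_comm a b : odot a b = odot b a.
Proof.
apply functional_extensionality; intros i; apply functional_extensionality; intros j.
unfold odot; ring.
Qed.

Lemma inner_d_grad_perp_long phi a : Ck 2 phi ->
  inner (sym_d (grad_perp phi)) (odot a a) = Dir a (Dir (opp_vec (perp a)) phi).
Proof.
intros H; rewrite inner_d_grad_perp by exact H.
apply functional_extensionality; intros x; field.
Qed.

(** Rotating [perp a] back gives [a], and the two derivatives commute. *)
Lemma inner_d_grad_perp_trans phi a : Ck 2 phi ->
  inner (sym_d (grad_perp phi)) (odot (perp a) (perp a)) = Dir a (Dir (perp a) phi).
Proof.
intros H; rewrite inner_d_grad_perp_long, Dir_comm by exact H.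
f_equal; destruct a; unfold opp_vec, perp; simpl; now rewrite !Ropp_involutive.
Qed.

(** [X_u (D_u (D_a phi)) + X_v (D_v (D_b phi))] equals [- D_(a+b) phi], which is
    [- c D_e phi]; integrating along [e] returns [c phi].  Each of the six
    reconstruction formulas is the instance for its own [a], [b], [e] and [c]. *)
Lemma vline_reconstruction (u v a b e : R2) (c k : R) (phi h1 h2 T : R2 -> R) :
  nonzero_vec u -> nonzero_vec v -> nonzero_vec e -> Ck 2 phi -> bounded_supp phi ->
  h1 = Dir u (Dir a phi) -> h2 = Dir v (Dir b phi) ->
  fst a + fst b = c * fst e -> snd a + snd b = c * snd e -> k * c = 1 ->
  (forall x, T x = Xray u h1 x + Xray v h2 x) ->
  forall x, ex_half_int (fun s => T (shift x s e)) /\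
    phi x = k * half_int (fun s => T (shift x s e)).
Proof.
intros Hu Hv He Hphi Hs -> -> E1 E2 Hk HT x.
assert (E : (fun s => T (shift x s e)) = (fun s => scal (- c) (Dir e phi (shift x s e)))).
{ apply functional_extensionality; intros s; rewrite HT, !Xray_Dir; auto;
    try (now apply Ck_Dir); try (now apply (bounded_supp_Dir 1)).
  unfold Dir, scal; simpl; unfold mult; simpl.
  replace (fst a) with (c * fst e - fst b) by lra.
  replace (snd a) with (c * snd e - snd b) by lra; ring. }
assert (HI : is_RInt_gen (fun s => T (shift x s e)) (at_point 0) (Rbar_locally p_infty)
  (scal (- c) (- phi x))).
{ rewrite E; apply (is_RInt_gen_scal (V := R_NormedModule)).
  apply half_int_Dir; auto; now apply Ck_S. }
split; [eexists; exact HI|].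
rewrite (half_int_unique _ _ HI).
unfold scal; simpl; unfold mult; simpl.
replace (k * (- c * - phi x)) with ((k * c) * phi x) by ring; rewrite Hk; ring.
Qed.

(** [g = - X_a (D_a g)]: a compactly supported function that is constant along
    parallel lines vanishes. *)
Lemma Dir_eq_0 a g : nonzero_vec a -> Ck 1 g -> bounded_supp g ->
  (forall x, Dir a g x = 0) -> forall x, g x = 0.
Proof.
intros Ha Hg Hs H x.
assert (E := half_int_unique _ _ (half_int_Dir a g x Ha Hg Hs)).
rewrite (half_int_finite _ 0), RInt_point in E; [|lra| |auto].
- change zero with 0 in E; lra.
- intros t; apply continuous_ext with (fun _ => 0); [intros; now rewrite H|cont].
Qed.

(** Integrating by parts twice moves [D_a] off [f] and [D_b] onto [f]; the order
    of the derivatives of [g] is immaterial.  Only one derivative of [f] is used, so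
    [f] may be a first derivative of a function of class C^2. *)
Lemma plane_int_Dir_swap a b f g : Ck 1 f -> Ck 2 g -> bounded_supp f -> bounded_supp g ->
  plane_int (fun x => Dir a f x * Dir b g x) = plane_int (fun x => Dir b f x * Dir a g x).
Proof.
intros Hf Hg Sf Sg.
rewrite !plane_int_parts; auto; try (now apply Ck_Dir); try (now apply (bounded_supp_Dir 1)).
now rewrite Dir_comm.
Qed.

(** * The mixed transform and the second-order equation *)

Definition pde_op (u : R2) (h : R2 -> R) : R2 -> R := fun x =>
  (1 + 2 * fst u ^ 2) * pd i1 (pd i1 h) x + (fst u ^ 2 - snd u ^ 2) * pd i2 (pd i2 h) x.

Lemma Cc_pd2 i j h : Ck 2 h -> bounded_supp h -> Cc (pd i (pd j h)).
Proof. intros; apply (Cc_pd 0); [now apply Ck_pd|now apply bounded_supp_pd]. Qed.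

Lemma pde_op_sub u f g x : Ck 2 f -> Ck 2 g ->
  pde_op u (fun y => f y + -1 * g y) x = pde_op u f x - pde_op u g x.
Proof.
intros Hf Hg.
assert (E : forall i h k, Ck 1 h -> Ck 1 k ->
  pd i (fun y => h y + -1 * k y) = fun y => pd i h y + -1 * pd i k y).
{ intros i h k Hh Hk; apply functional_extensionality; intros y.
  rewrite pd_plus, pd_scal; auto; try (now apply (Ck_ex_pd 0)).
  now apply (Ck_ex_pd 0), Ck_scal. }
unfold pde_op; rewrite !E; try (now apply Ck_S); try (now apply Ck_pd).
ring.
Qed.

Lemma Cc_pde_op u h : Ck 2 h -> bounded_supp h -> Cc (pde_op u h).
Proof. intros; apply Cc_plus; apply Cc_scal; now apply Cc_pd2. Qed.

(** Each ray contributes [int (X_a A_a) (D_a D_b chi) = int A_a (D_b chi)].  The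
    sum [A_u (D_v chi) + A_v (D_u chi)] is
    [u2 (u1^2 - u2^2) (phi_11 - phi_22) chi_2 - 4 u1^2 u2 phi_12 chi_1]; under the
    integral [phi_12 chi_1] may be replaced by [phi_11 chi_2], and [|u| = 1]
    collects the coefficients into [pde_op]. *)
Lemma plane_int_Mvline_Dir_Dir u v phi chi :
  unit_vector u -> fst u <> 0 -> v = (- fst u, snd u) ->
  Ck 2 phi -> bounded_supp phi -> Ck 2 chi -> bounded_supp chi ->
  plane_int (fun x => Mvline u v (sym_d (grad_perp phi)) x * Dir v (Dir u chi) x)
  = - snd u * plane_int (fun x => pde_op u phi x * Dir e2 chi x).
Proof.
intros Hu Hu1 Hv Hphi Sphi Hchi Schi.
set (A := fun a => inner (sym_d (grad_perp phi)) (odot a (perp a))).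
assert (HA : forall a, Cc (A a)).
{ intros a; unfold A; rewrite inner_d_grad_perp by exact Hphi.
  apply Cc_scal, Cc_plus; apply (Cc_Dir 0);
    try (now apply Ck_Dir); now apply (bounded_supp_Dir 1). }
assert (Nu : nonzero_vec u) by now left.
assert (Nv : nonzero_vec v) by (rewrite Hv; left; simpl; lra).
assert (C1 : forall a, Ck 1 (Dir a chi)) by (intros; now apply Ck_Dir).
assert (S1 : forall a, bounded_supp (Dir a chi)) by (intros; now apply (bounded_supp_Dir 1)).
assert (CX : forall a b c, nonzero_vec a -> Cc (fun x => Xray a (A a) x * Dir b (Dir c chi) x)).
{ intros; apply Cc_mult_l; [now apply continuous_Xray|now apply (Cc_Dir 0)]. }
assert (CA : forall a b, Cc (fun x => A a x * Dir b chi x)).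
{ intros; apply Cc_mult_r; [apply HA|now apply (Ck_continuous 1)]. }
rewrite (plane_int_ext _ (fun x => Xray u (A u) x * Dir u (Dir v chi) x
                                   + Xray v (A v) x * Dir v (Dir u chi) x)).
2:{ intros x; rewrite (Dir_comm u v) by exact Hchi; unfold Mvline; fold (A u) (A v); ring. }
rewrite plane_int_plus by now apply CX.
rewrite !plane_int_Xray_Dir, <- plane_int_plus by auto.
assert (Cp : Cc (fun x => Dir e1 (pd i1 phi) x * Dir e2 chi x)).
{ apply Cc_mult_l; [|now apply (Cc_Dir 1)].
  now apply (Ck_continuous 0), Ck_Dir, Ck_pd. }
assert (Cq : Cc (fun x => Dir e2 (pd i1 phi) x * Dir e1 chi x)).
{ apply Cc_mult_l; [|now apply (Cc_Dir 1)].
  now apply (Ck_continuous 0), Ck_Dir, Ck_pd. }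
assert (Ce : Cc (fun x => pde_op u phi x * Dir e2 chi x)).
{ apply Cc_mult_r; [now apply Cc_pde_op|now apply (Ck_continuous 1)]. }
assert (Hsw : plane_int (fun x => Dir e1 (pd i1 phi) x * Dir e2 chi x)
            = plane_int (fun x => Dir e2 (pd i1 phi) x * Dir e1 chi x)).
{ apply plane_int_Dir_swap; auto; [now apply Ck_pd|now apply bounded_supp_pd]. }
rewrite (plane_int_ext _ (fun x => - snd u * (pde_op u phi x * Dir e2 chi x)
  + (4 * fst u ^ 2 * snd u * (Dir e1 (pd i1 phi) x * Dir e2 chi x)
     + - (4 * fst u ^ 2 * snd u) * (Dir e2 (pd i1 phi) x * Dir e1 chi x)))).
- rewrite !plane_int_plus, !plane_int_scal, Hsw; try ring;
    repeat first [apply Cc_plus | apply Cc_scal]; auto.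
- intros x; unfold A; rewrite !inner_d_grad_perp by exact Hphi.
  rewrite !Dir_Dir, Hv by exact Hphi.
  unfold pde_op, Dir, opp_vec, perp, e1, e2; simpl fst; simpl snd.
  unfold unit_vector in Hu.
  set (p11 := pd i1 (pd i1 phi) x); set (p22 := pd i2 (pd i2 phi) x);
  set (p12 := pd i2 (pd i1 phi) x); set (c1 := pd i1 chi x); set (c2 := pd i2 chi x).
  set (s := fst u) in *; set (w := snd u) in *; clearbody p11 p22 p12 c1 c2 s w.
  (* The two sides differ by this multiple of 1 - |u|^2. *)
  assert (E : p11 * c2 * w * (1 - (s ^ 2 + w ^ 2)) = 0) by (rewrite Hu; ring).
  apply Rminus_diag_uniq; etransitivity; [|exact E]; field.
Qed.

(** The derivative falls on the translated factor, the continuous factor [E] being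
    fixed. *)
Lemma is_derive_plane_int_translate e E psi t : Cc E -> Ck 1 psi ->
  is_derive (fun t => plane_int (fun x => E x * psi (shift x (-1) (t * fst e, t * snd e)))) t
    (- plane_int (fun x => E x * Dir e psi (shift x (-1) (t * fst e, t * snd e)))).
Proof.
intros HE Hpsi; assert (C0 := Ck_continuous _ _ Hpsi).
assert (C1 := Ck_continuous _ _ (Ck_Dir 0 e _ Hpsi)).
assert (HE' := HE); destruct HE' as [CE [M [HM H0]]].
replace (- plane_int _) with (plane_int (fun x =>
   -1 * (E x * Dir e psi (shift x (-1) (t * fst e, t * snd e))))).
2:{ rewrite plane_int_scal; [ring|]; apply Cc_mult_r; [exact HE|cont]. }
apply (is_derive_plane_int
  (fun t x => E x * psi (shift x (-1) (t * fst e, t * snd e)))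
  (fun t x => -1 * (E x * Dir e psi (shift x (-1) (t * fst e, t * snd e)))) t M).
- exact HM.
- intros s x.
  assert (D := is_derive_along psi _ e (fun y => is_derive_Dir psi e y Hpsi) x (- s)).
  assert (Eq : forall r, shift x (-1) (r * fst e, r * snd e) = shift x (- r) e).
  { intros r; unfold shift; simpl; f_equal; ring. }
  apply is_derive_ext with (fun r => scal (E x) (psi (shift x (- r) e))).
  { intros r; now rewrite Eq. }
  rewrite Eq.
  replace (-1 * (E x * Dir e psi (shift x (- s) e)))
    with (scal (E x) (scal (-1) (Dir e psi (shift x (- s) e))))
    by (unfold scal; simpl; unfold mult; simpl; ring).
  apply (is_derive_scal (fun r => psi (shift x (- r) e)) s (E x)).
  apply (is_derive_comp (fun r => psi (shift x r e)) (fun r => - r)); [exact D|].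
  auto_derive; auto; ring.
- cont.
- cont.
- intros s x _ Hx; rewrite (H0 x Hx); ring.
- intros x Hx; rewrite (H0 x Hx); ring.
Qed.

(** The integrand is minus the derivative of the pairing of [E] with the translate
    of [psi] by [t e], and this pairing vanishes once the supports are disjoint. *)
Lemma half_int_plane_int_Dir e E psi :
  nonzero_vec e -> Cc E -> Ck 2 psi -> bounded_supp psi ->
  is_RInt_gen (fun t => plane_int (fun x => E x * Dir e psi (shift x (-1) (t * fst e, t * snd e))))
    (at_point 0) (Rbar_locally p_infty) (plane_int (fun x => E x * psi x)).
Proof.
intros He HE Hpsi Sp.
set (F := fun t => plane_int (fun x => E x * psi (shift x (-1) (t * fst e, t * snd e)))).
assert (HE' := HE); destruct HE' as [_ [M [HM H1]]]; destruct Sp as [M' [HM' H2]].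
assert (Hne : nonzero_vec (opp_vec e)) by (destruct He; [left|right]; simpl; lra).
destruct (ray_escapes (opp_vec e) M' M Hne) as [N [_ HN]]; [lra|].
replace (plane_int (fun x => E x * psi x)) with (- - F 0).
- replace (- - F 0) with (- (- 1 * F 0)) by ring.
  apply (half_int_primitive (fun t => - 1 * F t) _ N).
  + intros t.
    replace (plane_int _) with (scal (-1) (- plane_int (fun x =>
      E x * Dir e psi (shift x (-1) (t * fst e, t * snd e)))))
      by (unfold scal; simpl; unfold mult; simpl; ring).
    apply (is_derive_scal F t (-1)), is_derive_plane_int_translate; [exact HE|now apply Ck_S].
  + intros t; apply (ex_derive_continuous (V := R_NormedModule)).
    (* The integrand of the half-line integral has the same form with psi replaced by
       Dir e psi, so it is differentiable and a fortiori continuous. *)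
    eexists; apply is_derive_plane_int_translate; [exact HE|now apply Ck_Dir].
  + intros t Ht; unfold F.
    rewrite (plane_int_ext _ (fun x => 0 * E x)).
    { rewrite plane_int_scal by exact HE; ring. }
    intros x; destruct (classic (M < Rabs (fst x) \/ M < Rabs (snd x))) as [Hx|Hx].
    * rewrite (H1 x Hx); ring.
    * assert (Rabs (fst x) <= M) by (apply Rnot_lt_le; tauto).
      assert (Rabs (snd x) <= M) by (apply Rnot_lt_le; tauto).
      replace (shift x (-1) (t * fst e, t * snd e)) with (shift x t (opp_vec e))
        by (unfold shift; simpl; f_equal; ring).
      rewrite H2; [ring|now apply HN].
- rewrite Ropp_involutive; apply plane_int_ext; intros x; do 2 f_equal.
  destruct x; unfold shift; simpl; f_equal; ring.
Qed.

Lemma Ck_of_test psi : test_function psi -> Ck 2 psi /\ bounded_supp psi.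
Proof. intros [H [r Hr]]; split; [apply H|exact (supp_disc_bounded r psi Hr)]. Qed.

(** Translation commutes with directional derivatives, so the integrand at [t] is
    the pairing computed in [plane_int_Mvline_Dir_Dir] for the translate of [psi]. *)
Lemma distr_Xray_Mvline u v phi psi :
  unit_vector u -> fst u <> 0 -> v = (- fst u, snd u) ->
  Ck 2 phi -> bounded_supp phi -> test_function psi ->
  is_RInt_gen (fun t => distr_shift (t * fst e2, t * snd e2)
     (distr_Dir u (distr_Dir v (distr_of (Mvline u v (sym_d (grad_perp phi)))))) psi)
    (at_point 0) (Rbar_locally p_infty)
    (- snd u * plane_int (fun x => pde_op u phi x * psi x)).
Proof.
intros Hu Hu1 Hv Hphi Sphi Hpsi; destruct (Ck_of_test psi Hpsi) as [Cpsi Spsi].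
assert (HE := Cc_pde_op u phi Hphi Sphi).
assert (Ne2 : nonzero_vec e2) by (right; simpl; lra).
assert (HI := half_int_plane_int_Dir e2 _ psi Ne2 HE Cpsi Spsi).
apply (is_RInt_gen_scal (V := R_NormedModule) _ (- snd u)) in HI.
revert HI; apply is_RInt_gen_ext.
apply filter_forall; intros p t _.
set (b := (t * fst e2, t * snd e2)); clearbody b.
assert (Cs : Ck 2 (fun y => psi (shift y (-1) b))) by now apply Ck_shift.
assert (Ss : bounded_supp (fun y => psi (shift y (-1) b))).
{ destruct Spsi as [M [HM H]]; exists (M + Rabs (fst b) + Rabs (snd b)).
  assert (B1 := Rabs_pos (fst b)); assert (B2 := Rabs_pos (snd b)).
  split; [lra|]; intros x Hx; apply H; simpl.
  replace (fst x + -1 * fst b) with (fst x - fst b) by ring.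
  replace (snd x + -1 * snd b) with (snd x - snd b) by ring.
  assert (T1 := Rabs_triang_inv (fst x) (fst b)).
  assert (T2 := Rabs_triang_inv (snd x) (snd b)).
  destruct Hx; [left|right]; lra. }
assert (P := plane_int_Mvline_Dir_Dir u v phi _ Hu Hu1 Hv Hphi Sphi Cs Ss).
rewrite (Dir_shift e2) in P by now apply Ck_S.
unfold scal; simpl; unfold mult; simpl.
unfold distr_shift, distr_Dir; rewrite Ropp_involutive.
symmetry; exact P.
Qed.

(** * Bump functions *)

(** The functions [t^(-n) exp (- 1 / t)], extended by 0.  Their linear span is
    stable under differentiation, which makes them smooth all at once. *)
Definition flat (n : nat) (t : R) : R :=
  if Rlt_dec 0 t then (/ t) ^ n * exp (- / t) else 0.

Lemma flat_pos n t : 0 < t -> flat n t = (/ t) ^ n * exp (- / t).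
Proof. intros; unfold flat; destruct Rlt_dec; [reflexivity|lra]. Qed.

Lemma flat_npos n t : t <= 0 -> flat n t = 0.
Proof. intros; unfold flat; destruct Rlt_dec; [lra|reflexivity]. Qed.

Lemma flat_ge_0 n t : 0 <= flat n t.
Proof.
unfold flat; destruct Rlt_dec as [Ht|]; [|lra].
apply Rmult_le_pos; [apply pow_le, Rlt_le, Rinv_0_lt_compat, Ht|apply Rlt_le, exp_pos].
Qed.

Lemma flat_gt_0 t : 0 < t -> 0 < flat 0 t.
Proof. intros; rewrite flat_pos by assumption; simpl; rewrite Rmult_1_l; apply exp_pos. Qed.

Lemma exp_mult_nat k y : exp (INR k * y) = exp y ^ k.
Proof.
induction k as [|k IH]; [simpl; now rewrite Rmult_0_l, exp_0|].
rewrite S_INR; simpl; rewrite <- IH, <- exp_plus; f_equal; ring.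
Qed.

(** [exp s = exp (s / k) ^ k] and [exp y >= 1 + y >= y]. *)
Lemma pow_le_exp k s : 0 <= s -> s ^ k <= INR k ^ k * exp s.
Proof.
intros Hs; destruct k as [|k].
- simpl; assert (H := exp_ineq1_le s); lra.
- assert (Hk : 0 < INR (S k)) by apply lt_0_INR, Nat.lt_0_succ.
  replace (exp s) with (exp (INR (S k) * (s / INR (S k)))) by (f_equal; field; lra).
  rewrite exp_mult_nat, <- Rpow_mult_distr.
  apply pow_incr; split; [exact Hs|].
  assert (H := exp_ineq1_le (s / INR (S k))).
  replace s with (INR (S k) * (s / INR (S k))) at 1 by (field; lra).
  apply Rmult_le_compat_l; lra.
Qed.

(** The bound [s^(n+1) <= C exp s] at [s = 1 / t]. *)
Lemma flat_le n : exists C, 0 < C /\ forall t, flat n t <= C * Rabs t.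
Proof.
exists (INR (S n) ^ S n); split; [apply pow_lt, lt_0_INR, Nat.lt_0_succ|].
intros t; destruct (Rlt_dec 0 t) as [Ht|Ht].
- rewrite flat_pos, (Rabs_pos_eq t) by lra.
  assert (Hi := Rinv_0_lt_compat t Ht).
  assert (H := pow_le_exp (S n) (/ t) (Rlt_le _ _ Hi)).
  rewrite exp_Ropp; assert (He := exp_pos (/ t)).
  apply Rmult_le_reg_r with (exp (/ t) * / t); [now apply Rmult_lt_0_compat|].
  replace ((/ t) ^ n * / exp (/ t) * (exp (/ t) * / t)) with ((/ t) ^ S n)
    by (simpl; field; split; lra).
  replace (INR (S n) ^ S n * t * (exp (/ t) * / t)) with (INR (S n) ^ S n * exp (/ t))
    by (field; lra).
  exact H.
- rewrite flat_npos by lra.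
  apply Rmult_le_pos; [apply pow_le, pos_INR|apply Rabs_pos].
Qed.

(** At 0 the difference quotient of [flat n] is [flat (S n)], which tends to 0. *)
Lemma is_derive_flat n t :
  is_derive (flat n) t (- INR n * flat (S n) t + flat (S (S n)) t).
Proof.
destruct (Rtotal_order t 0) as [Ht|[Ht|Ht]].
- rewrite !flat_npos by lra.
  apply is_derive_ext_loc with (fun _ => 0).
  + generalize (open_lt 0 t Ht); apply filter_imp; intros s Hs; now rewrite flat_npos by lra.
  + replace (- INR n * 0 + 0) with 0 by ring; apply (is_derive_const (V := R_NormedModule)).
- subst t; rewrite !flat_npos by lra; replace (- INR n * 0 + 0) with 0 by ring.
  apply is_derive_Reals; intros eps Heps.
  destruct (flat_le (S n)) as (C & HC & HF).
  exists (mkposreal (eps / C) (Rdiv_lt_0_compat _ _ Heps HC)); intros h Hh Hd; simpl in Hd.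
  rewrite Rplus_0_l, (flat_npos n 0), !Rminus_0_r by lra.
  assert (E : flat n h / h = flat (S n) h).
  { destruct (Rlt_dec 0 h); [rewrite !flat_pos by assumption; simpl; field; lra|].
    rewrite !flat_npos by lra; field; exact Hh. }
  rewrite E, Rabs_pos_eq by apply flat_ge_0.
  apply Rle_lt_trans with (1 := HF h).
  apply Rlt_div_r in Hd; [lra|exact HC].
- apply is_derive_ext_loc with (fun t => (/ t) ^ n * exp (- / t)).
  + generalize (open_gt 0 t Ht); apply filter_imp; intros s Hs; now rewrite flat_pos.
  + rewrite !flat_pos by exact Ht; auto_derive; [lra|].
    destruct n as [|n]; [simpl; field; lra|].
    change (pred (S n)) with n; change ((/ t) ^ S (S n)) with (/ t * (/ t * (/ t) ^ n)).
    change ((/ t) ^ S (S (S n))) with (/ t * (/ t * (/ t * (/ t) ^ n))).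
    change ((/ t) ^ S n) with (/ t * (/ t) ^ n); field; lra.
Qed.

Lemma Ck_flat k n i c d : Ck k (fun x => flat n (c * coord i x + d)).
Proof.
assert (Hc : forall m t, continuous (flat m) t).
{ intros m t; apply (ex_derive_continuous (V := R_NormedModule)); eexists; apply is_derive_flat. }
revert n; induction k as [|k IH]; intros n.
all: assert (H0 : continuousR2 (fun x => flat n (c * coord i x + d)))
  by (intros x; apply (continuous_comp (fun x : R * R => c * coord i x + d) (flat n));
      [destruct i; simpl; cont|apply Hc]); split; [exact H0|].
1: exact I.
assert (HD : forall x,
  is_derive (fun t => flat n (c * t + d)) x
    (c * (- INR n * flat (S n) (c * x + d) + flat (S (S n)) (c * x + d)))).
{ intros x; apply (is_derive_comp (flat n) (fun t => c * t + d));
    [apply is_derive_flat|auto_derive; auto; ring]. }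
assert (Hd : Ck k (fun x =>
   c * (- INR n * flat (S n) (c * coord i x + d) + flat (S (S n)) (c * coord i x + d))))
  by (apply Ck_scal, Ck_plus; [apply Ck_scal|]; apply IH).
intros j; destruct i, j; simpl in *.
- split; [intros x; eexists; apply HD|].
  replace (pd _ _) with (fun x : R2 =>
    c * (- INR n * flat (S n) (c * fst x + d) + flat (S (S n)) (c * fst x + d))); [exact Hd|].
  apply functional_extensionality; intros x; symmetry; apply is_derive_unique, HD.
- split; [intros x; apply (ex_derive_const (V := R_NormedModule))|].
  replace (pd _ _) with (fun _ : R2 => 0); [apply Ck_const|].
  apply functional_extensionality; intros x; symmetry; apply (Derive_const (flat n (c * fst x + d))).
- split; [intros x; apply (ex_derive_const (V := R_NormedModule))|].
  replace (pd _ _) with (fun _ : R2 => 0); [apply Ck_const|].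
  apply functional_extensionality; intros x; symmetry; apply (Derive_const (flat n (c * snd x + d))).
- split; [intros x; eexists; apply HD|].
  replace (pd _ _) with (fun x : R2 =>
    c * (- INR n * flat (S n) (c * snd x + d) + flat (S (S n)) (c * snd x + d))); [exact Hd|].
  apply functional_extensionality; intros x; symmetry; apply is_derive_unique, HD.
Qed.

(** The closure of the set where [h] does not vanish lies in the square of
    half-side [M + 1], hence in the disc of radius [2 (M + 1)]. *)
Lemma test_function_of_bounded h M :
  (forall k, Ck k h) -> (forall x, h x <> 0 -> Rabs (fst x) <= M /\ Rabs (snd x) <= M) ->
  test_function h.
Proof.
intros Hk Hb; split; [exact Hk|].
exists (2 * (M + 1)); intros x Hx; apply NNPP; intros Hd; apply Hx.
exists (mkposreal 1 Rlt_0_1); intros [y1 y2] [Hy1 Hy2].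
change (Rabs (y1 - fst x) < 1) in Hy1; change (Rabs (y2 - snd x) < 1) in Hy2.
apply NNPP; intros Hy; destruct (Hb _ Hy) as [B1 B2]; simpl in B1, B2; apply Hd.
assert (T1 := Rabs_triang_inv (fst x) y1); assert (T2 := Rabs_triang_inv (snd x) y2).
rewrite Rabs_minus_sym in Hy1, Hy2.
assert (Hsq : forall a, Rabs a <= M + 1 -> a ^ 2 <= (M + 1) ^ 2).
{ intros a Ha; rewrite <- (pow2_abs a); apply pow_incr; split; [apply Rabs_pos|exact Ha]. }
unfold Defs.disc.
assert (Q1 := Hsq (fst x)); assert (Q2 := Hsq (snd x)).
assert (P := Rabs_pos y1); nra.
Qed.

(** A product of four functions [flat 0], one for each side of the square. *)
Lemma bump_exists x0 d : 0 < d -> exists chi, test_function chi /\ (forall x, 0 <= chi x) /\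
  0 < chi x0 /\
  forall x, chi x <> 0 -> Rabs (fst x - fst x0) < d /\ Rabs (snd x - snd x0) < d.
Proof.
intros Hd.
set (f := fun i c (x : R2) => flat 0 (c * coord i x + (d - c * coord i x0))).
set (chi := fun x => f i1 1 x * f i1 (-1) x * (f i2 1 x * f i2 (-1) x)).
assert (Hf : forall i c x, f i c x <> 0 -> 0 < c * (coord i x - coord i x0) + d).
{ intros i c x H; apply Rnot_le_lt; intros Hle; apply H; unfold f; apply flat_npos; lra. }
assert (Hs : forall x, chi x <> 0 -> Rabs (fst x - fst x0) < d /\ Rabs (snd x - snd x0) < d).
{ intros x Hx.
  assert (H : f i1 1 x <> 0 /\ f i1 (-1) x <> 0 /\ f i2 1 x <> 0 /\ f i2 (-1) x <> 0)
    by (repeat split; intros E; apply Hx; unfold chi; rewrite E; ring).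
  destruct H as (H1 & H2 & H3 & H4); apply Hf in H1, H2, H3, H4; simpl in *.
  split; apply Rabs_def1; lra. }
exists chi; split; [|split; [|split; [|exact Hs]]].
- apply test_function_of_bounded with (Rabs (fst x0) + Rabs (snd x0) + d).
  + intros k; unfold chi, f; repeat apply Ck_mult; apply Ck_flat.
  + intros x Hx; destruct (Hs x Hx) as [B1 B2].
    assert (T1 := Rabs_triang_inv (fst x) (fst x0)).
    assert (T2 := Rabs_triang_inv (snd x) (snd x0)).
    assert (P1 := Rabs_pos (fst x0)); assert (P2 := Rabs_pos (snd x0)); lra.
- intros x; unfold chi, f; repeat apply Rmult_le_pos; apply flat_ge_0.
- unfold chi, f; repeat apply Rmult_lt_0_compat; apply flat_gt_0; lra.
Qed.

(** * Uniqueness *)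

(** If [f - g] is positive at [x], it is positive on a small square; its product
    with a bump function supported there is nonnegative with integral 0, so it
    vanishes at [x]. *)
Lemma distr_of_inj f g : continuousR2 f -> continuousR2 g ->
  distr_eq (distr_of f) (distr_of g) -> forall x, f x = g x.
Proof.
assert (Hle : forall f g, continuousR2 f -> continuousR2 g ->
  distr_eq (distr_of f) (distr_of g) -> forall x, f x <= g x).
{ intros p q Hp Hq E x; apply Rnot_lt_le; intros Hlt.
  set (D := fun y => p y + -1 * q y).
  assert (HD : continuousR2 D) by (unfold D; cont).
  assert (HDx : 0 < D x) by (unfold D; lra).
  destruct (proj1 (filterlim_locally _ _) (HD x) (mkposreal _ HDx)) as [d Hd].
  destruct (bump_exists x d (cond_pos d)) as (chi & Htest & Hpos & Hx & Hsupp).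
  destruct (Ck_of_test chi Htest) as [Ck2 Sc].
  assert (Cchi := Cc_Ck 2 chi Ck2 Sc).
  assert (Cp : Cc (fun y => p y * chi y)) by now apply Cc_mult_l.
  assert (Cq : Cc (fun y => q y * chi y)) by now apply Cc_mult_l.
  assert (Hz : D x * chi x = 0).
  { apply (plane_int_eq_0 (fun y => D y * chi y)).
    - now apply Cc_mult_l.
    - intros y; destruct (Req_dec (chi y) 0) as [->|Hy]; [lra|].
      destruct (Hsupp y Hy) as [B1 B2].
      assert (Hb : Rabs (D y - D x) < D x) by (apply Hd; split; assumption).
      apply Rmult_le_pos; [|apply Hpos].
      revert Hb; unfold Rabs; destruct Rcase_abs; lra.
    - rewrite (plane_int_ext _ (fun y => p y * chi y + -1 * (q y * chi y)))
        by (intros; unfold D; ring).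
      rewrite plane_int_plus, plane_int_scal; auto; [|now apply Cc_scal].
      assert (E' := E chi Htest).
      change (plane_int (fun y => p y * chi y) = plane_int (fun y => q y * chi y)) in E'.
      lra. }
  assert (0 < D x * chi x) by now apply Rmult_lt_0_compat.
  lra. }
intros Hf Hg E x; apply Rle_antisym; apply Hle; auto.
intros psi Hpsi; symmetry; now apply E.
Qed.

(** For [be <= 0] the operator is the product of the derivatives along
    [(sqrt al, sqrt (- be))] and [(sqrt al, - sqrt (- be))].  For [be > 0] it is
    elliptic, and multiplying by [w] and integrating by parts gives
    [int (al w_1^2 + be w_2^2) = 0]. *)
Lemma second_order_eq_0 al be w : 0 < al -> Ck 2 w -> bounded_supp w ->
  (forall x, al * pd i1 (pd i1 w) x + be * pd i2 (pd i2 w) x = 0) ->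
  forall x, w x = 0.
Proof.
intros Hal Hw Sw H.
assert (C1 : forall a, Ck 1 (Dir a w)) by (intros; now apply Ck_Dir).
assert (S1 : forall a, bounded_supp (Dir a w)) by (intros; now apply (bounded_supp_Dir 1)).
assert (W1 : Ck 1 w) by now apply Ck_S.
destruct (Rle_lt_dec be 0) as [Hbe|Hbe].
- assert (Hsa : sqrt al <> 0) by (apply Rgt_not_eq, sqrt_lt_R0, Hal).
  assert (Ea : sqrt al * sqrt al = al) by (apply sqrt_sqrt; lra).
  assert (Eb : sqrt (- be) * sqrt (- be) = - be) by (apply sqrt_sqrt; lra).
  apply (Dir_eq_0 (sqrt al, sqrt (- be))); auto; [now left|].
  apply (Dir_eq_0 (sqrt al, - sqrt (- be))); auto; [now left|].
  intros x; rewrite Dir_Dir by exact Hw; simpl fst; simpl snd.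
  rewrite <- (H x).
  set (s := sqrt al) in *; set (r := sqrt (- be)) in *; clearbody s r.
  rewrite <- Ea; replace be with (- (r * r)) by lra; ring.
- assert (Cxx : forall a b, Cc (fun x => Dir a w x * Dir b w x)).
  { intros; apply Cc_mult_l; [now apply (Ck_continuous 1)|now apply (Cc_Dir 1)]. }
  assert (Cw : forall a b, Cc (fun x => w x * Dir a (Dir b w) x)).
  { intros; apply Cc_mult_l; [now apply (Ck_continuous 2)|now apply (Cc_Dir 0)]. }
  assert (Cs : forall a, Cc (fun x => Dir a w x * Dir a w x)) by auto.
  assert (Hparts : forall a, plane_int (fun x => Dir a w x * Dir a w x)
     = - plane_int (fun x => w x * Dir a (Dir a w) x)) by (intros; now apply plane_int_parts).
  assert (Z : plane_int (fun x => al * (Dir e1 w x * Dir e1 w x) + be * (Dir e2 w x * Dir e2 w x)) = 0).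
  { rewrite plane_int_plus, !plane_int_scal, !Hparts; try (now apply Cc_scal); auto.
    transitivity (-1 * plane_int (fun x => al * (w x * Dir e1 (Dir e1 w) x)
       + be * (w x * Dir e2 (Dir e2 w) x))).
    - rewrite plane_int_plus, !plane_int_scal; try (now apply Cc_scal); auto; ring.
    - rewrite (plane_int_ext _ (fun x => 0 * (w x * Dir e1 (Dir e1 w) x))).
      + rewrite plane_int_scal by auto; ring.
      + intros x; rewrite !Dir_Dir by exact Hw; unfold e1, e2; simpl fst; simpl snd.
        transitivity (w x * (al * pd i1 (pd i1 w) x + be * pd i2 (pd i2 w) x)); [ring|].
        rewrite H; ring. }
  assert (Hsq : forall r : R, 0 <= r * r) by (intros r; apply Rle_0_sqr).
  apply (Dir_eq_0 e1); auto; [left; simpl; lra|].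
  intros x.
  assert (Zx := plane_int_eq_0 _ (Cc_plus _ _ (Cc_scal al _ (Cs e1)) (Cc_scal be _ (Cs e2)))).
  specialize (fun h => Zx h Z x); cbv beta in Zx.
  assert (Q1 := Hsq (Dir e1 w x)); assert (Q2 := Hsq (Dir e2 w x)).
  assert (Q3 : be * (Dir e2 w x * Dir e2 w x) >= 0) by (apply Rle_ge, Rmult_le_pos; lra).
  assert (Q4 : al * (Dir e1 w x * Dir e1 w x) = 0).
  { assert (0 <= al * (Dir e1 w x * Dir e1 w x)) by (apply Rmult_le_pos; lra).
    enough (al * (Dir e1 w x * Dir e1 w x) + be * (Dir e2 w x * Dir e2 w x) = 0) by lra.
    apply Zx; intros y; apply Rplus_le_le_0_compat; apply Rmult_le_pos; auto; lra. }
  apply Rmult_integral in Q4; destruct Q4 as [Q4|Q4]; [lra|].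
  apply Rmult_integral in Q4; tauto.
Qed.

(** * Reconstruction of the potential *)

Theorem theorem5 (r1 : R) (Hr1 : 0 < r1)
  (u v : R2) (Hu : unit_vector u) (Hv : v = (- fst u, snd u))
  (Huv : lin_indep u v)
  (phi : R2 -> R) (Hphi : Cck 2 r1 phi) :
  (* f = d^2 phi *)
  (let f := sym_d (grad phi) in
   forall x : R2,
     (ex_half_int (fun s => Lvline u v f (shift x s e2)) /\
      phi x = 1 / (2 * snd u) * half_int (fun s => Lvline u v f (shift x s e2))) /\
     (ex_half_int (fun s => Mvline u v f (shift x s e1)) /\
      phi x = - (1 / (2 * snd u)) * half_int (fun s => Mvline u v f (shift x s e1))))
  /\
  (* f = (d^perp)^2 phi *)
  (let f := sym_d_perp (grad_perp phi) in
   forall x : R2,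
     (ex_half_int (fun s => Tvline u v f (shift x s e2)) /\
      phi x = 1 / (2 * snd u) * half_int (fun s => Tvline u v f (shift x s e2))) /\
     (ex_half_int (fun s => Mvline u v f (shift x s e1)) /\
      phi x = 1 / (2 * snd u) * half_int (fun s => Mvline u v f (shift x s e1))))
  /\
  (* f = d d^perp phi *)
  (let f := sym_d (grad_perp phi) in
   (forall x : R2,
     (ex_half_int (fun s => Lvline u v f (shift x s e1)) /\
      phi x = 1 / (2 * snd u) * half_int (fun s => Lvline u v f (shift x s e1))) /\
     (ex_half_int (fun s => Tvline u v f (shift x s e1)) /\
      phi x = - (1 / (2 * snd u)) * half_int (fun s => Tvline u v f (shift x s e1))))
   /\
   ex_distr_Xray e2 (distr_Dir u (distr_Dir v (distr_of (Mvline u v f)))) /\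
   mixed_pde u v (Mvline u v f) phi /\
   (forall psi : R2 -> R,
      Cck 2 r1 psi -> mixed_pde u v (Mvline u v f) psi ->
      forall x : R2, psi x = phi x)).
Proof.
assert (Hu12 : fst u <> 0 /\ snd u <> 0).
(* If u1 = 0 then u = v, and if u2 = 0 then u = - v. *)
{ split; intros E.
  - destruct (Huv 1 (-1)); [rewrite Hv, E; simpl; ring|rewrite Hv; simpl; ring|lra].
  - destruct (Huv 1 1); [rewrite Hv; simpl; ring|rewrite Hv, E; simpl; ring|lra]. }
destruct Hu12 as [Hu1 Hu2].
assert (Nu : nonzero_vec u) by now left.
assert (Nv : nonzero_vec v) by (rewrite Hv; left; simpl; lra).
assert (N1 : nonzero_vec e1) by (left; simpl; lra).
assert (N2 : nonzero_vec e2) by (right; simpl; lra).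
destruct Hphi as [C2 Sd]; assert (S2 := supp_disc_bounded r1 phi Sd).
split; [|split]; intros f.
- intros x; split.
  + apply (vline_reconstruction u v u v e2 (2 * snd u) _ phi
      (inner f (odot u u)) (inner f (odot v v)));
      auto; try (now apply inner_d_grad); try (rewrite Hv; simpl; ring); field; auto.
  + apply (vline_reconstruction u v (perp u) (perp v) e1 (- (2 * snd u)) _ phi
      (inner f (odot u (perp u))) (inner f (odot v (perp v))));
      auto; try (now apply inner_d_grad); try (rewrite Hv; simpl; ring); field; auto.
- intros x; split.
  + apply (vline_reconstruction u v (opp_vec (perp (perp u))) (opp_vec (perp (perp v))) e2 (2 * snd u) _ phi
      (inner f (odot (perp u) (perp u))) (inner f (odot (perp v) (perp v))));
      auto; try (now apply inner_d_perp_grad_perp); try (rewrite Hv; simpl; ring); field; auto.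
  + apply (vline_reconstruction u v (opp_vec (perp u)) (opp_vec (perp v)) e1 (2 * snd u) _ phi
      (inner f (odot u (perp u))) (inner f (odot v (perp v))));
      auto; try (rewrite odot_comm; now apply inner_d_perp_grad_perp);
      try (rewrite Hv; simpl; ring); field; auto.
- assert (Hpde : mixed_pde u v (Mvline u v f) phi).
  { intros psi Hpsi; unfold distr_scal, distr_Xray, f.
    rewrite (half_int_unique _ _ (distr_Xray_Mvline u v phi psi Hu Hu1 Hv C2 S2 Hpsi)).
    change (plane_int (fun x => pde_op u phi x * psi x)
      = - (1 / snd u) * (- snd u * plane_int (fun x => pde_op u phi x * psi x))).
    field; exact Hu2. }
  split; [|split; [|split]].
  + intros x; split.
    * apply (vline_reconstruction u v (opp_vec (perp u)) (opp_vec (perp v)) e1 (2 * snd u) _ phi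
        (inner f (odot u u)) (inner f (odot v v)));
        auto; try (now apply inner_d_grad_perp_long); try (rewrite Hv; simpl; ring); field; auto.
    * apply (vline_reconstruction u v (perp u) (perp v) e1 (- (2 * snd u)) _ phi
        (inner f (odot (perp u) (perp u))) (inner f (odot (perp v) (perp v))));
        auto; try (now apply inner_d_grad_perp_trans); try (rewrite Hv; simpl; ring); field; auto.
  + intros psi Hpsi; eexists; now apply distr_Xray_Mvline.
  + exact Hpde.
  + intros psi [C2' Sd'] Hpsi; assert (S2' := supp_disc_bounded r1 psi Sd').
    assert (Cw : Cc (fun x => psi x + -1 * phi x)).
    { apply Cc_plus; [|apply Cc_scal]; now apply (Cc_Ck 2). }
    assert (Hop : forall x, pde_op u psi x = pde_op u phi x).
    { apply distr_of_inj; [now apply Cc_pde_op|now apply Cc_pde_op|].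
      intros chi Hchi; transitivity (distr_scal (- (1 / snd u)) (distr_Xray e2
        (distr_Dir u (distr_Dir v (distr_of (Mvline u v f))))) chi);
        [now apply Hpsi|symmetry; now apply Hpde]. }
    assert (Hw : forall x, psi x + -1 * phi x = 0).
    { apply (second_order_eq_0 (1 + 2 * fst u ^ 2) (fst u ^ 2 - snd u ^ 2)).
      - assert (H := pow2_ge_0 (fst u)); lra.
      - now apply Ck_plus, Ck_scal.
      - apply Cw.
      - intros x; change (pde_op u (fun x => psi x + -1 * phi x) x = 0).
        rewrite pde_op_sub, Hop by assumption; ring. }
    intros x; specialize (Hw x); lra.
Qed.
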